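(* Let $d\ge 1$ and $1\le k\le d$ be integers. Let $(M,\oplus,\le,e)$ be a totally ordered unital magma. Let $\mathcal{G}$ be a family of subsets of $\mathbb{R}^d$ that is closed under unions and contains $\mathbb{R}^d$ and every open halfspace. Let $\mu_1,\dots,\mu_k:\mathcal{G}\to M$ be set functions that are monotone and $\mathcal{H}$-subadditive, and such that each $\mu_i$ is concentrated on some bounded set. Then there exists a $(k-1)$-flat $\pi\subseteq\mathbb{R}^d$ such that $$(d-k+2)\,\mu_i(h)\ \ge\ \mu_i(\mathbb{R}^d)\qquad\text{for all } i=1,\dots,k,$$ for every open halfspace $h$ containing $\pi$.
   Context: A totally ordered unital magma $(M,\oplus,\le,e)$ is a totally ordered set $M$ with a binary operation $\oplus:M\times M\to M$ having a neutral element $e$ ($x\oplus e=x=e\oplus x$ for all $x$) and which is monotone ($a\le b$ implies $a\oplus c\le b\oplus c$ and $c\oplus a\le c\oplus b$). For $x\in M$ and a positive integer $c$, $cx$ denotes $x\oplus(x\oplus(\cdots\oplus x)\cdots)$ with $c$ copies of $x$. $\mathcal{H}$ denotes the set of all open halfspaces of $\mathbb{R}^d$. A set function $\mu:\mathcal{G}\to M$ is monotone if $\mu(X)\le\mu(Y)$ whenever $X\subseteq Y$; it is $\mathcal{H}$-subadditive if for every finite set $\{h_1,\dots,h_m\}\subseteq\mathcal{H}$ (in any order) $\mu(h_1\cup\cdots\cup h_m)\le \mu(h_1)\oplus(\mu(h_2)\oplus(\cdots\oplus\mu(h_m))\cdots)$; it is concentrated on a set $X$ if $\mu(h)=e$ for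 every $h\in\mathcal{H}$ with $h\cap X=\emptyset$. *)

(* Defs.v *)
From Stdlib Require Import Reals List.
From mathcomp Require Import all_boot.
Set Implicit Arguments.
Unset Strict Implicit.

Open Scope R_scope.

Definition point (d : nat) := 'I_d -> R.
Definition pset (d : nat) := point d -> Prop.

Definition rsum {I : Type} (l : list I) (f : I -> R) : R :=
  fold_right (fun i acc => f i + acc) 0 l.

Definition dot {d : nat} (a x : point d) : R :=
  rsum (enum 'I_d) (fun i => a i * x i).

Definition sub_set {d : nat} (X Y : pset d) : Prop := forall x, X x -> Y x.
Definition set_eq {d : nat} (X Y : pset d) : Prop := forall x, X x <-> Y x.
Definition full_set (d : nat) : pset d := fun _ => True.
Arguments full_set d : clear implicits.
Definition union {d : nat} (X Y : pset d) : pset d := fun x => X x \/ Y x.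
Definition big_union {d : nat} (hs : list (pset d)) : pset d :=
  fun x => exists h, In h hs /\ h x.

Definition open_halfspace {d : nat} (h : pset d) : Prop :=
  exists (a : point d) (b : R), (exists i, a i <> 0) /\
    forall x, h x <-> dot a x > b.

Definition bounded_set {d : nat} (X : pset d) : Prop :=
  exists r : R, forall x, X x -> forall i, Rabs (x i) <= r.

Definition is_flat {d : nat} (k : nat) (pi : pset d) : Prop :=
  exists (p : point d) (v : 'I_k -> point d),
    (forall t : 'I_k -> R,
        (forall c : 'I_d, rsum (enum 'I_k) (fun j => t j * v j c) = 0) ->
        forall j, t j = 0) /\
    forall x, pi x <-> exists t : 'I_k -> R,
        forall c : 'I_d, x c = p c + rsum (enum 'I_k) (fun j => t j * v j c).

Record tou_magma {M : Type} (le : M -> M -> Prop) (op : M -> M -> M) (e : M)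
  : Prop := {
  tm_refl : forall x, le x x;
  tm_antisym : forall x y, le x y -> le y x -> x = y;
  tm_trans : forall x y z, le x y -> le y z -> le x z;
  tm_total : forall x y, le x y \/ le y x;
  tm_unit_r : forall x, op x e = x;
  tm_unit_l : forall x, op e x = x;
  tm_mono_l : forall a b c, le a b -> le (op a c) (op b c);
  tm_mono_r : forall a b c, le a b -> le (op c a) (op c b)
}.

Fixpoint mmul {M : Type} (op : M -> M -> M) (e : M) (c : nat) (x : M) : M :=
  match c with
  | O => e
  | S c' => match c' with
            | O => x
            | _ => op x (mmul op e c' x)
            end
  end.

Fixpoint mfold {M : Type} (op : M -> M -> M) (v : M) (vs : list M) : M :=
  match vs with
  | nil => v
  | w :: ws => op v (mfold op w ws)
  end.

Fixpoint distinct_sets {d : nat} (hs : list (pset d)) : Prop :=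
  match hs with
  | nil => True
  | h :: hs' => (forall h', In h' hs' -> ~ set_eq h h') /\ distinct_sets hs'
  end.

Definition good_family {d : nat} (G : pset d -> Prop) : Prop :=
  (forall X Y, G X -> G Y -> G (union X Y)) /\
  G (full_set d) /\
  (forall h, open_halfspace h -> G h).

Definition monotone_on {d : nat} {M : Type} (le : M -> M -> Prop)
  (G : pset d -> Prop) (mu : pset d -> M) : Prop :=
  forall X Y, G X -> G Y -> sub_set X Y -> le (mu X) (mu Y).

(** H-subadditivity: for every finite set {h1,...,hm} (m >= 1) of open
    halfspaces, in any order,
    mu(h1 u ... u hm) <= mu h1 op (mu h2 op (... op mu hm)). *)
Definition H_subadditive {d : nat} {M : Type} (le : M -> M -> Prop)
  (op : M -> M -> M) (mu : pset d -> M) : Prop :=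
  forall (h : pset d) (hs : list (pset d)),
    Forall open_halfspace (h :: hs) -> distinct_sets (h :: hs) ->
    le (mu (big_union (h :: hs))) (mfold op (mu h) (map mu hs)).

Definition concentrated_on {d : nat} {M : Type} (e : M)
  (mu : pset d -> M) (X : pset d) : Prop :=
  forall h, open_halfspace h -> (forall x, ~ (h x /\ X x)) -> mu h = e.

(* Main.v *)
Require Import Defs.
From Stdlib Require Import Reals List.
From mathcomp Require Import all_boot.
From mathcomp Require Import all_order all_algebra zify ring lra.
From mathcomp Require Import boolp classical_sets reals Rstruct.
From mathcomp Require topology normedtype sequences.
Set Implicit Arguments.
Unset Strict Implicit.
Unset Printing Implicit Defensive.
Import Order.TTheory GRing.Theory Num.Theory.
Local Open Scope ring_scope.

(** Write [n = d - k + 1]. For a vector [a], let [phi_i a] be the infimum of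
    the [b] such that the halfspace [a.y > b] has too small a [mu_i]-measure.
    Then [phi_i] is Lipschitz and positively homogeneous, and H-subadditivity
    says that it is nonnegative in total on any [n + 1] vectors with sum 0. By
    Caratheodory and Hahn-Banach (in effect Helly's theorem for the projections
    to [R^n]), for every [n x d] matrix [U] there is a center [c] in [R^n] with
    [c.w <= phi_i (w U)] for all [w], and the flat [U x = c] is deep for [mu_i]
    if [U] has full rank. It remains to find [U] of full rank with a common
    center for all [i].

    Centers are averaged over a finite net with a partition of unity, so that
    they depend continuously on [U] and odd-equivariantly on the signs of its
    rows. Let the [i]-th row range over the sphere of dimension [k - 1 + i]
    ([i < n]). The equations "the centers of [mu_j] and [mu_0] have the same
    [i]-th coordinate" ([x_i]) and "rows [l] and [i] are orthogonal"
    ([x_l + x_i]) have a common approximate zero, because the product of their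
    mod 2 Euler classes in the product of projective spaces contains the top
    monomial with coefficient 1: taking from each class the variable of largest
    index is the only way to produce it. This Borsuk-Ulam type statement is
    proved on cubical chains over F_2, where the boundary of the hemisphere of
    dimension [a + 1] is the sum of a hemisphere of dimension [a] and its
    antipode. Compactness gives an exact zero. *)

Local Notation F2 := 'F_2.


(** * Chains mod 2 on products of cubical spheres *)

Lemma F2_addxx (x : F2) : x + x = 0.
Proof. by case: x => [[|[|//]]] i; apply/val_inj. Qed.

Lemma F2_natb (b1 b2 : bool) : (b1 (+) b2)%:R = b1%:R + b2%:R :> F2.
Proof. by case: b1 b2 => [] []; apply/val_inj. Qed.

(** Off-diagonal terms cancel in pairs mod 2; [r] orders the indices so as to select one term of
    each pair. *)
Lemma F2_sum_sym (J : finType) (f : J -> J -> F2) :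
  (forall j l, f j l = f l j) -> (forall j, f j j = 0) ->
  \sum_j \sum_l f j l = 0.
Proof.
move=> fS f0; pose r (j l : J) := (enum_rank j < enum_rank l)%N.
have splt j : \sum_l f j l = \sum_(l | r j l) f j l + \sum_(l | r l j) f l j.
  rewrite (bigID (r j)) /=; congr (_ + _).
  rewrite (bigID (fun l => l == j)) /= big1 ?add0r; last first.
    by move=> l /andP[_ /eqP->].
  rewrite (eq_bigl (fun l => r l j)); first by apply: eq_bigr => l _; exact: fS.
  move=> l; rewrite /r -leqNgt leq_eqVlt.
  have -> : (nat_of_ord (enum_rank l) == enum_rank j) = (l == j).
    by apply/eqP/eqP => [/val_inj/enum_rank_inj //|->].
  by case: eqP => [->|]; rewrite ?ltnn //= andbT.
rewrite (eq_bigr _ (fun j _ => splt j)) big_split /=.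
rewrite [X in _ + X](exchange_big_dep xpredT) //=.
exact: F2_addxx.
Qed.

(** A point of a product of [n] spheres is a matrix with one row per sphere, and this is the
    antipode on the [i]-th factor. *)
Definition flip (V : zmodType) n D (i : 'I_n) (A : 'M[V]_(n, D)) : 'M[V]_(n, D) :=
  \matrix_(k, l) if k == i then - A k l else A k l.

Lemma flipK (V : zmodType) n D (i : 'I_n) : involutive (@flip V n D i).
Proof. by move=> A; apply/matrixP => k l; rewrite mxE; case: ifP => ki; rewrite mxE ki ?opprK. Qed.

Section Grid.
Variable m : nat.
Hypothesis m_gt0 : (0 < m)%N.

(* Half-integer grid on the interval [-m, m]: even residues are vertices, odd
   ones are edges, and the residue [2m+1 = -(2m+1)] lies outside. *)
Notation Zq := 'Z_((4 * m).+2).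

Lemma val_Zq_add1 (x : Zq) : val (x + 1) = if val x == (4 * m).+1 then 0%N else (val x).+1.
Proof.
rewrite /= modnDmr addn1; have := ltn_ord x; rewrite /= -/(Zp_trunc _).
case: eqP => [->|/eqP neq] lt; first by rewrite modnn.
by rewrite modn_small // ltn_neqAle lt andbT eqSS.
Qed.

Lemma val_Zq_opp (x : Zq) : val (- x) = if val x == 0%N then 0%N else ((4 * m).+2 - val x)%N.
Proof.
rewrite /=; have := ltn_ord x; rewrite /= -/(Zp_trunc _).
case: eqP => [->|/eqP neq] lt; first by rewrite subn0 modnn.
by rewrite modn_small // ltn_subrL lt0n neq.
Qed.

Lemma val_Zq_sub1 (x : Zq) :
  val (x - 1) = if val x == 0%N then (4 * m).+1 else (val x).-1.
Proof.
have := val_Zq_add1 (x - 1); rewrite subrK; move: (x - 1) => y -> {x}.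
by case: (val y =P (4 * m).+1).
Qed.

Lemma Zq_lt (x : Zq) : (val x < (4 * m).+2)%N.
Proof. exact: ltn_ord. Qed.

Lemma Zq_eq_nat (x y : Zq) : (x == y) = (val x == val y).
Proof. by []. Qed.

Lemma odd_Zq_add1 (x : Zq) : odd (x + 1)%R = ~~ odd x.
Proof.
rewrite (val_Zq_add1 x : nat_of_ord _ = _); case: eqP => [e|//]; rewrite [nat_of_ord x]e /= oddM //.
Qed.

Lemma odd_Zq_sub1 (x : Zq) : odd (x - 1)%R = ~~ odd x.
Proof. by rewrite -[in RHS](subrK 1 x) odd_Zq_add1 negbK. Qed.

Lemma odd_Zq_opp (x : Zq) : odd (- x)%R = odd x.
Proof.
have := ltn_ord x; rewrite (val_Zq_opp x : nat_of_ord _ = _) /= -/(Zp_trunc _).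
case: eqP => [-> //|_] lt; rewrite oddB 1?ltnW //.
by rewrite /= oddM.
Qed.

(** As chains, [icell] is the interval [-m, m] and [pcell] its half [0, m]; [ends] are the endpoints
    m and -m, stored as the residues 2m and 2m + 2, and [top] is m. *)
Definition icell (x : Zq) : bool := odd x && (val x != (2 * m).+1).
Definition pcell (x : Zq) : bool := odd x && (val x < 2 * m)%N.
Definition ends (x : Zq) : bool := (val x == 2 * m)%N || (val x == (2 * m).+2).
Definition top (x : Zq) : bool := (val x == 2 * m)%N.

Lemma icell_opp x : icell (- x) = icell x.
Proof.
have := Zq_lt x; rewrite /icell odd_Zq_opp val_Zq_opp => lt.
case: (odd x) => //=; apply/idP/idP; case: ifP; lia.
Qed.

Lemma icell_split x : icell x = pcell x (+) pcell (- x).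
Proof.
have := Zq_lt x.
rewrite /icell /pcell odd_Zq_opp val_Zq_opp => lt.
by have [ox|] := boolP (odd x) => //=; repeat case: ifP; lia.
Qed.

Definition bd1 (g : Zq -> F2) (x : Zq) : F2 := (~~ odd x)%:R * (g (x + 1) + g (x - 1)).

Lemma bd1_icell x : bd1 (fun y => (icell y)%:R) x = (ends x)%:R.
Proof.
have := Zq_lt x; rewrite /bd1 -F2_natb /icell odd_Zq_add1 odd_Zq_sub1.
rewrite /ends val_Zq_add1 val_Zq_sub1 => lt.
rewrite -natrM mulnb; congr (_%:R); congr (nat_of_bool _).
by case: (boolP (odd x)) => ox /=; repeat case: ifP; lia.
Qed.

Lemma bd1_pcell x : bd1 (fun y => (pcell y)%:R) x = (x == 0)%:R + (top x)%:R.
Proof.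
have := Zq_lt x; rewrite /bd1 -!F2_natb /pcell odd_Zq_add1 odd_Zq_sub1 Zq_eq_nat.
rewrite /top val_Zq_add1 val_Zq_sub1 => lt.
rewrite -natrM mulnb; congr (_%:R); congr (nat_of_bool _).
by case: (boolP (odd x)) => ox /=; repeat case: ifP; lia.
Qed.

Lemma bd1_zero x : bd1 (fun y => (y == 0)%:R) x = 0.
Proof.
have := Zq_lt x; rewrite /bd1 -!F2_natb !Zq_eq_nat.
rewrite val_Zq_add1 val_Zq_sub1 => lt.
rewrite -natrM mulnb (_ : _ && _ = false) //.
by case: (boolP (odd x)) => ox //=; case: ifP; case: ifP; lia.
Qed.

(** * Boundary and coboundary of cubical chains mod 2 *)

Section Cells.
Variables n D : nat.
Notation cell := 'M[Zq]_(n, D).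
Notation idx := ('I_n * 'I_D)%type.

Definition dir (j : idx) : cell := delta_mx j.1 j.2.

Definition par (c : cell) (j : idx) : bool := odd (c j.1 j.2).

Lemma dirE j l : dir j l.1 l.2 = (j == l)%:R.
Proof. by case: j l => [a b] [x y]; rewrite mxE /= xpair_eqE (eq_sym x) (eq_sym y). Qed.

Lemma par_add c j l : par (c + dir j) l = par c l (+) (j == l).
Proof.
rewrite /par mxE dirE; case: eqP => _; last by rewrite addr0 addbF.
by rewrite odd_Zq_add1 addbT.
Qed.

Lemma par_sub c j l : par (c - dir j) l = par c l (+) (j == l).
Proof. by rewrite -[in RHS](subrK (dir j) c) par_add addbK. Qed.

(* [partial_op true] is the coboundary and [partial_op false] the boundary in
   one direction, of the cubical complex whose edges are the odd coordinates. *)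
Definition partial_op (b : bool) (j : idx) (F : cell -> F2) (c : cell) : F2 :=
  (par c j == b)%:R * (F (c + dir j) + F (c - dir j)).

Definition total_op b F c := \sum_j partial_op b j F c.
Notation cobd := (total_op true).
Notation bdy := (total_op false).

(** The double sum is symmetric in the two directions. A repeated direction [j] contributes 0,
    because the first step changes the parity of coordinate [j], which both operators require to be
    [b]. *)
Lemma total_op_sq b F c : total_op b (total_op b F) c = 0.
Proof.
rewrite /total_op; under eq_bigr => j _.
  rewrite /partial_op -big_split /= mulr_sumr; over.
apply: F2_sum_sym => [j l|j]; last first.
  rewrite !par_add !par_sub eqxx addbT.
  by case: (par c j); case: b => /=; rewrite ?(mul0r, mulr0, addr0).
rewrite !par_add !par_sub (eq_sym l j); case: (eqVneq j l) => [->|_] //=.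
rewrite !addbF -!mulrDr !mulrA [in LHS](mulrC (_ == _)%:R); congr (_ * _).
rewrite [LHS]addrACA; congr (_ + _ + (_ + _)); congr (F _); first exact: addrAC.
- exact: addrAC.
- exact: addrAC.
- exact: addrAC.
Qed.

(** Translating the summation variable by one step moves each shift from [F] to [G] and swaps the
    parity of coordinate [j]. *)
Lemma partial_op_adj b j F G :
  \sum_c partial_op b j F c * G c = \sum_c F c * partial_op (~~ b) j G c.
Proof.
rewrite /partial_op.
under eq_bigr => c _ do rewrite mulrDr mulrDl.
under [RHS]eq_bigr => c _ do rewrite !mulrDr.
rewrite !big_split /= addrC; congr (_ + _).
  rewrite (reindex_inj (addIr (dir j))) /=; apply: eq_bigr => c _.
  rewrite addrK par_add eqxx addbT mulrAC mulrC; congr (_ * (_%:R * _)).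
  by case: (par c j) b => [] [].
rewrite (reindex_inj (addIr (- dir j))) /=; apply: eq_bigr => c _.
rewrite subrK par_sub eqxx addbT mulrAC mulrC; congr (_ * (_%:R * _)).
by case: (par c j) b => [] [].
Qed.

Lemma cobd_adj F G : \sum_c cobd F c * G c = \sum_c F c * bdy G c.
Proof.
rewrite /total_op.
under eq_bigr => c _ do rewrite mulr_suml.
under [RHS]eq_bigr => c _ do rewrite mulr_sumr.
rewrite exchange_big /= [RHS]exchange_big /=; apply: eq_bigr => j _.
exact: partial_op_adj.
Qed.

Lemma total_opD b F G c : total_op b (fun x => F x + G x) c = total_op b F c + total_op b G c.
Proof.
rewrite -big_split /=; apply: eq_bigr => j _.
by rewrite /partial_op -mulrDr addrACA.
Qed.

Lemma eq_total_op b F G : F =1 G -> total_op b F =1 total_op b G.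
Proof. by move=> eFG c; apply: eq_bigr => j _; rewrite /partial_op !eFG. Qed.

Lemma par_flip i c j : par (flip i c) j = par c j.
Proof. by rewrite /par mxE; case: ifP; rewrite ?odd_Zq_opp. Qed.

Lemma flip_dir i c j :
  (flip i (c + dir j), flip i (c - dir j)) =
  if j.1 == i then (flip i c - dir j, flip i c + dir j)
  else (flip i c + dir j, flip i c - dir j).
Proof.
case: (eqVneq j.1 i) => ji; congr (_, _); apply/matrixP => k l; rewrite !mxE ?ji;
  case: (eqVneq k i) => [->|/negbTE ki]; rewrite ?opprD ?opprK ?ki ?(eq_sym i) ?(negbTE ji) //=;
  by rewrite ?oppr0.
Qed.

Lemma total_op_flip i b F c : total_op b (fun x => F (flip i x)) c = total_op b F (flip i c).
Proof.
apply: eq_bigr => j _; rewrite /partial_op par_flip.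
have := flip_dir i c j; case: ifP => _ [-> ->] //; congr (_ * _); exact: addrC.
Qed.
End Cells.

Notation cobd := (total_op true).
Notation bdy := (total_op false).

(** * Hemispheres of the boundary of a cube *)

Section Hemispheres.
Variable D : nat.
Notation row_cell := 'rV[Zq]_D.
Implicit Types (g : 'I_D -> Zq -> F2) (x : row_cell).

Definition box_chain g x := \prod_j g j (x 0 j).

Definition upd g (j : 'I_D) (f : Zq -> F2) : 'I_D -> Zq -> F2 :=
  fun l => if l == j then f else g l.

Lemma box_chain_upd g j f x :
  box_chain (upd g j f) x = f (x 0 j) * \prod_(l | l != j) g l (x 0 l).
Proof.
rewrite /box_chain (bigD1 j) //= /upd eqxx; congr (_ * _).
by apply: eq_bigr => l /negbTE->.
Qed.

Lemma box_chain_dir g (j : 'I_D) x :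
  (box_chain g (x + dir (0, j)) = box_chain (upd g j (fun y => g j (y + 1))) x) *
  (box_chain g (x - dir (0, j)) = box_chain (upd g j (fun y => g j (y - 1))) x).
Proof.
split; rewrite box_chain_upd /box_chain (bigD1 j) //= !mxE !eqxx;
  congr (_ * _); apply: eq_bigr => l lj; rewrite !mxE (negbTE lj) andbF;
  by rewrite ?oppr0 addr0.
Qed.

Lemma total_op_row b (F : row_cell -> F2) x :
  total_op b F x = \sum_j partial_op b (0, j) F x.
Proof.
rewrite /total_op (eq_bigr (fun p => partial_op b (p.1, p.2) F x)); last by case.
by rewrite -(pair_bigA _ (fun i j => partial_op b (i, j) F x)) /= big_ord1.
Qed.

Lemma bdy_box_chain g x :
  bdy (box_chain g) x = \sum_j box_chain (upd g j (bd1 (g j))) x.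
Proof.
rewrite total_op_row; apply: eq_bigr => j _.
rewrite /partial_op !box_chain_dir !box_chain_upd -mulrDl mulrA /bd1 /par /=.
by case: (odd _).
Qed.

(* The chain of the box with sides [-m,m] (for coordinates below [a]) and
   [0,m] (for coordinate [a]), and that of its face opposite to the top face. *)
Definition half_box (a : nat) (j : 'I_D) (y : Zq) : F2 :=
  if (j < a)%N then (icell y)%:R else if j == a :> nat then (pcell y)%:R else (y == 0)%:R.
Definition base_box (a : nat) (j : 'I_D) (y : Zq) : F2 :=
  if (j < a)%N then (icell y)%:R else (y == 0)%:R.

(* The boundary of the half box without its base: the upper hemisphere of the
   boundary of the cube of dimension [a + 1]. *)
Definition hemi (a : nat) (x : row_cell) : F2 :=
  bdy (box_chain (half_box a)) x + box_chain (base_box a) x.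

Lemma bdy_hemi a x : bdy (hemi a) x = bdy (box_chain (base_box a)) x.
Proof. by rewrite total_opD total_op_sq add0r. Qed.

Lemma bdy_hemi0 x : bdy (hemi 0) x = 0.
Proof.
rewrite bdy_hemi bdy_box_chain big1 // => j _.
by rewrite box_chain_upd [X in X * _](bd1_zero (x 0 j)) mul0r.
Qed.

Lemma flip_row (x : row_cell) : flip 0 x = - x.
Proof. by apply/matrixP => i j; rewrite !mxE ord1 eqxx. Qed.

(** Splitting the last interval at 0 writes the base of the hemisphere of dimension a + 1 as
    [half_box a] plus its antipode. The two copies of [base_box a] in the right-hand side cancel
    because that box is symmetric. *)
Lemma bdy_hemiS a x : (a.+1 < D)%N ->
  bdy (hemi a.+1) x = hemi a x + hemi a (- x).
Proof.
move=> aD; have aD' := ltnW aD.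
rewrite bdy_hemi /hemi -!flip_row -total_op_flip addrACA -total_opD.
have base_even : box_chain (base_box a) (flip 0 x) = box_chain (base_box a) x.
  apply: eq_bigr => j _; rewrite flip_row mxE /base_box icell_opp.
  by rewrite oppr_eq0.
rewrite base_even F2_addxx addr0; apply: eq_total_op => {base_even}{}x.
rewrite flip_row.
have split_at (g : 'I_D -> Zq -> F2) y : box_chain g y =
    g (Ordinal aD') (y 0 (Ordinal aD')) * \prod_(l | l != Ordinal aD') g l (y 0 l).
  by rewrite -box_chain_upd; apply: eq_bigr => j _; rewrite /upd; case: eqP => [->|].
rewrite 3!split_at /base_box /half_box /= ltnSn ltnn eqxx mxE icell_split F2_natb mulrDl.
congr (_ * _ + _ * _); apply: eq_bigr => l /negbTE la; rewrite ltnS leq_eqVlt;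
  rewrite -[l == a :> nat]/(l == Ordinal aD') la //= mxE icell_opp.
by rewrite oppr_eq0.
Qed.

(** The cells of the boundary of the cube with sides [-m, m]; the second condition excludes the
    residue outside the interval. *)
Definition on_sphere (x : row_cell) : bool :=
  [exists j, ends (x 0 j)] && [forall j, val (x 0 j) != (2 * m).+1].


(** The face of the half box at 0 in direction [a] is the base and cancels against it. What is left
    are both end faces in the directions below [a] and the top face in direction [a]. *)
Lemma hemiE a x (aD : (a < D)%N) : hemi a x =
  \sum_(j < D | (j < a)%N) box_chain (upd (half_box a) j (fun y => (ends y)%:R)) x
  + box_chain (upd (half_box a) (Ordinal aD) (fun y => (top y)%:R)) x.
Proof.
rewrite /hemi bdy_box_chain (bigID (fun j : 'I_D => (j < a)%N)) /= -addrA; congr (_ + _).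
  apply: eq_bigr => j ja; rewrite !box_chain_upd; congr (_ * _).
  rewrite -bd1_icell /bd1 /half_box ja //.
rewrite (bigD1 (Ordinal aD)) ?ltnn //= big1 ?addr0; last first.
  move=> j /andP[ja nja]; rewrite box_chain_upd.
  rewrite -[X in X * _](_ : 0 = _) ?mul0r // -(bd1_zero (x 0 j)) /bd1 /half_box.
  by rewrite (negbTE ja) -[j == a :> nat]/(j == Ordinal aD) (negbTE nja).
rewrite !box_chain_upd /half_box /= ltnn eqxx bd1_pcell mulrDl addrAC.
rewrite [X in X + _ + _](_ : _ = box_chain (base_box a) x) ?F2_addxx ?add0r //.
rewrite /box_chain [RHS](bigD1 (Ordinal aD)) //= /base_box /= ltnn; congr (_ * _).
by apply: eq_bigr => l la; rewrite -[l == a :> nat]/(l == Ordinal aD) (negbTE la).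
Qed.

Lemma hemi_on_sphere a x : (a < D)%N -> hemi a x != 0 -> on_sphere x.
Proof.
move=> aD; rewrite (hemiE x aD) => nz.
have ends_in y : ends y -> val y != (2 * m).+1 by rewrite /ends; lia.
have box_ends j (f : pred Zq) : (forall y, f y -> ends y) ->
    box_chain (upd (half_box a) j (fun y => (f y)%:R)) x != 0 -> ends (x 0 j).
  by move=> fe; rewrite box_chain_upd; case: (boolP (f _)) => [/fe|]; rewrite ?mul0r ?eqxx.
have [j [f [xj nzp]]] : exists j f, ends (x 0 j) /\ box_chain (upd (half_box a) j f) x != 0.
  have [e|nz1] := eqVneq (box_chain (upd (half_box a) (Ordinal aD) (fun y => (top y)%:R)) x) 0.
    move: nz; rewrite e addr0 => nz.
    have [j /andP[_ nzj]|all0] := pickP (fun j : 'I_D => (j < a)%N &&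
      (box_chain (upd (half_box a) j (fun y => (ends y)%:R)) x != 0)).
      by exists j, (fun y => (ends y)%:R); split=> //; exact: box_ends nzj.
    move: nz; rewrite big1 ?eqxx // => j ja; move: (all0 j); rewrite ja /=.
    by move/negbFE/eqP.
  exists (Ordinal aD), (fun y => (top y)%:R); split=> //; apply: box_ends nz1.
  by rewrite /ends /top => y ->.
apply/andP; split; first by apply/existsP; exists j.
apply/forallP => l; have [->|lj] := eqVneq l j; first exact: ends_in.
move: nzp; rewrite box_chain_upd; apply: contraNneq => xl.
rewrite (bigD1 l) //= [X in _ * (X * _)](_ : _ = 0) ?mul0r ?mulr0 //.
rewrite /half_box; case: ifP => _; first by rewrite /icell xl eqxx andbF.
by case: ifP => _; rewrite ?Zq_eq_nat ?xl // /pcell xl ltnNge leqnSn andbF.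
Qed.

Lemma hemi0E x : (0 < D)%N ->
  hemi 0 x = (x == \row_j (if j == 0 :> nat then (2 * m)%:R else 0))%:R.
Proof.
move=> D0; rewrite (hemiE x D0) big_pred0 // add0r.
have val2m : val ((2 * m)%:R : Zq) = (2 * m)%N.
  by rewrite [LHS](@val_Zp_nat (4 * m).+2 isT) modn_small //; lia.
case: eqP => [->|nx].
  rewrite /box_chain big1 // => j _; rewrite mxE /upd /half_box -[j == Ordinal D0]/(j == 0 :> nat) /=.
  by case: eqP => // _; rewrite /top val2m eqxx.
apply/eqP; apply: contra_notT nx => nz; apply/rowP => j; rewrite mxE.
move: nz; rewrite /box_chain (bigD1 j) //= /upd /half_box -[j == Ordinal D0]/(j == 0 :> nat).
rewrite mulf_eq0 negb_or => /andP[+ _]; have [_|_] := boolP (j == 0 :> nat).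
  by rewrite /top; case: (val (x 0 j) =P _) => // e _; apply/val_inj; rewrite e val2m.
by rewrite ltn0; case: (x 0 j =P 0).
Qed.
End Hemispheres.

(** * Products of hemispheres and cup products of sign functions *)

Section Parity.
Variables n D : nat.
Notation cell := 'M[Zq]_(n, D).
Implicit Types (a : 'I_n -> nat) (c : cell).

Definition hemis a c : F2 := \prod_i hemi (a i) (row i c).

Definition decr a (i : 'I_n) : 'I_n -> nat := fun k => if k == i then (a k).-1 else a k.

Lemma row_dir_eq i j c :
  (row i (c + dir (i, j)) = row i c + dir (0, j)) * (row i (c - dir (i, j)) = row i c - dir (0, j)).
Proof. by split; apply/rowP => l; rewrite !mxE /= !eqxx. Qed.

Lemma row_dir_neq i k j c : k != i ->
  (row k (c + dir (i, j)) = row k c) * (row k (c - dir (i, j)) = row k c).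
Proof.
by move=> /negbTE ki; split; apply/rowP => l; rewrite !mxE /= ki ?oppr0 addr0.
Qed.

Lemma partial_op_hemis i j a c :
  partial_op false (i, j) (hemis a) c =
  (\prod_(k | k != i) hemi (a k) (row k c)) * partial_op false (0, j) (hemi (a i)) (row i c).
Proof.
rewrite /partial_op /hemis !(bigD1 (P := xpredT) i) //= !row_dir_eq [RHS]mulrCA.
have -> : par (row i c) (0, j) = par c (i, j) by rewrite /par mxE.
congr (_ * _).
rewrite mulrDr ![_ * hemi _ _]mulrC.
by congr (_ * _ + _ * _); apply: eq_bigr => k ki; rewrite row_dir_neq.
Qed.

Lemma row_flip i k c : row k (flip i c) = if k == i then - row k c else row k c.
Proof. by apply/rowP => l; rewrite !mxE; case: ifP => ki; rewrite !mxE. Qed.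

(** The Leibniz rule, with each factor's boundary given by [bdy_hemiS]; factors of dimension 0 are
    cycles. *)
Lemma bdy_hemis a c : (forall i, (a i < D)%N) ->
  bdy (hemis a) c = \sum_(i | (0 < a i)%N) (hemis (decr a i) c + hemis (decr a i) (flip i c)).
Proof.
move=> aD; rewrite /total_op (eq_bigr (fun p => partial_op false (p.1, p.2) (hemis a) c));
  last by case.
rewrite -(pair_bigA _ (fun i j => partial_op false (i, j) (hemis a) c)) /=.
rewrite [RHS]big_mkcond /=; apply: eq_bigr => i _.
under eq_bigr => j _ do rewrite partial_op_hemis.
rewrite -mulr_sumr -total_op_row; have := aD i; case ai: (a i) => [|b] /= bD.
  by rewrite bdy_hemi0 mulr0.
rewrite bdy_hemiS // /hemis !(bigD1 (P := xpredT) i) //= !row_flip eqxx /decr eqxx ai /=.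
rewrite mulrDr ![_ * hemi _ _]mulrC.
by congr (_ * _ + _ * _); apply: eq_bigr => k ki; rewrite ?row_flip (negbTE ki).
Qed.

Definition on_spheres c : bool := [forall i, on_sphere (row i c)].

Lemma hemis_on_spheres a c : (forall i, (a i < D)%N) -> hemis a c != 0 -> on_spheres c.
Proof.
move=> aD nz; apply/forallP => i; apply: (hemi_on_sphere (aD i)).
by apply: contraNneq nz => z; rewrite /hemis (bigD1 i) //= z mul0r.
Qed.

(** Endpoint coordinates are even, hence different from the odd one that moves, and the new value is
    even, hence not the outside residue. *)
Lemma on_spheres_face c j : par c j -> on_spheres c ->
  on_spheres (c + dir j) && on_spheres (c - dir j).
Proof.
case: j => i0 j0; rewrite /par /= => oc /forallP K.
suff gen (c' : cell) : ~~ odd (c' i0 j0) ->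
   (forall k l, (k, l) != (i0, j0) -> c' k l = c k l) -> on_spheres c'.
  apply/andP; split; apply: gen.
  - by have := par_add c (i0, j0) (i0, j0); rewrite /par eqxx oc /= => ->.
  - by move=> k l kl; rewrite mxE (dirE _ (k, l)) eq_sym (negbTE kl) addr0.
  - by have := par_sub c (i0, j0) (i0, j0); rewrite /par eqxx oc /= => ->.
  - by move=> k l kl; rewrite 2!mxE (dirE _ (k, l)) eq_sym (negbTE kl) subr0.
move=> ec' same; apply/forallP => k; have /andP[/existsP[l el] /forallP inn] := K k.
apply/andP; split.
  apply/existsP; exists l; move: el; rewrite !mxE; have [[-> ->]|kl] := eqVneq (k, l) (i0, j0).
    by move: oc; rewrite /ends => + /orP[] /eqP e; rewrite [nat_of_ord _]e /= oddM.
  by rewrite same.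
apply/forallP => l'; have := inn l'; rewrite !mxE.
have [[-> ->] _|kl] := eqVneq (k, l') (i0, j0); last by rewrite same.
by apply: contra ec' => /eqP e; rewrite [nat_of_ord _]e /= oddM.
Qed.

Variables (I : eqType) (supp : I -> pred 'I_n) (sg : I -> cell -> bool).
Hypothesis sg_flip : forall e i c, on_spheres c -> sg e (flip i c) = sg e c (+) supp e i.
Implicit Types l : seq I.

(* The cup product of the coboundaries of the sign functions [sg e], [e \in l],
   evaluated on the barycentric subdivision of the cells. *)
Fixpoint cup l : cell -> F2 := match l with
  | [::] => fun c => \prod_j (~~ par c j)%:R
  | e :: l => cobd (fun c => (sg e c)%:R * cup l c)
  end.

Lemma cobd_cup l c : cobd (cup l) c = 0.
Proof.
case: l => [|e l]; last exact: total_op_sq.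
rewrite /total_op big1 // => j _; rewrite /partial_op /=.
rewrite [X in X + _](_ : _ = \prod_j0 (~~ par (c - dir j) j0)%:R) ?F2_addxx ?mulr0 //.
by apply: eq_bigr => j0 _; rewrite par_add par_sub.
Qed.

(** The antipode adds the constant [supp e i] to the sign function, which changes the value by a
    multiple of [cobd (cup l)], and this is 0. *)
Lemma cup_flip l i c : on_spheres c -> cup l (flip i c) = cup l c.
Proof.
elim: l c => [|e l IH] c Kc /=.
  by apply: eq_bigr => j _; rewrite par_flip.
rewrite -total_op_flip /total_op.
have Z : \sum_j (supp e i)%:R * partial_op true j (cup l) c = 0.
  by rewrite -mulr_sumr -/(total_op _ _ _) cobd_cup mulr0.
rewrite -[RHS]addr0 -[X in _ = _ + X]Z -big_split /=.
apply: eq_bigr => j _; rewrite /partial_op; case: (boolP (par c j)) => pj; last by rewrite !mul0r mulr0 addr0.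
have /andP[K1 K2] := on_spheres_face pj Kc.
rewrite !mul1r !sg_flip // !IH // !F2_natb; ring.
Qed.

(** The coefficient mod 2 of the monomial with exponents [a] in the product, over [e] in [l], of the
    sums of the variables in [supp e]. *)
Fixpoint coef l a : F2 := match l with
  | [::] => [forall i, a i == 0%N]%:R
  | e :: l => \sum_(i | supp e i && (0 < a i)%N) coef l (decr a i)
  end.

(** By adjointness one coboundary becomes the boundary of [hemis a], a sum of hemispheres and their
    antipodes. Reindexing the antipodal sum by [flip i] leaves the sum of the signs at a cell and
    its antipode, that is [supp e i], in front of an evaluation with one class fewer. At the end
    [hemis a] is the single vertex [c0]. *)
Lemma cup_hemis l a : (forall i, (a i < D)%N) -> (\sum_i a i)%N = size l ->
  \sum_c cup l c * hemis a c = coef l a.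
Proof.
elim: l a => [|e l IH] a aD /= sz.
  have a0 i : a i = 0%N by apply/eqP; rewrite -leqn0 -sz (bigD1 i) //= leq_addr.
  have -> : [forall i, a i == 0%N] by apply/forallP => i; rewrite a0.
  pose c0 : cell := \matrix_(i, j) (if j == 0 :> nat then (2 * m)%:R else 0).
  have He c : hemis a c = (c == c0)%:R.
    have [->|ne] := eqVneq c c0.
      rewrite /hemis big1 // => i _; rewrite a0 hemi0E ?(leq_ltn_trans _ (aD i)) //.
      by rewrite (_ : _ == _ = true) //; apply/eqP/rowP => j; rewrite !mxE.
    apply/eqP; apply: contraNT ne => nz; apply/eqP/matrixP => i j; rewrite mxE.
    move: nz; rewrite /hemis (bigD1 i) //= mulf_eq0 negb_or a0 hemi0E ?(leq_ltn_trans _ (aD i)) //.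
    case/andP; case: (row i c =P _) => // e _ _; have := congr1 (fun x : 'rV_D => x 0 j) e.
    by rewrite !mxE.
  rewrite (bigD1 c0) //= He eqxx mulr1 [X in _ + X]big1 ?addr0; last first.
    by move=> c /negbTE nc; rewrite He nc mulr0.
  rewrite big1 // => j _; rewrite /par mxE; case: ifP => // _.
  by rewrite (@val_Zp_nat (4 * m).+2 isT) modn_small ?oddM //; lia.
rewrite (cobd_adj _ (hemis a)).
under [LHS]eq_bigr => c _ do rewrite (bdy_hemis c aD) mulr_sumr.
rewrite exchange_big /= big_mkcondl /=; apply: eq_bigr => i ai.
have aD' k : (decr a i k < D)%N by rewrite /decr; case: ifP => // _; exact: leq_ltn_trans (leq_pred _) (aD k).
have sz' : (\sum_k decr a i k)%N = size l.
  apply: succn_inj; rewrite -sz (bigD1 i) //= [RHS](bigD1 i) //= /decr eqxx -addSn prednK //.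
  by congr (_ + _)%N; apply: eq_bigr => k /negbTE ->.
transitivity (\sum_c (supp e i)%:R * (cup l c * hemis (decr a i) c)); last first.
  by rewrite -mulr_sumr IH //; case: (supp e i); rewrite ?mul1r ?mul0r.
under eq_bigr => c _ do rewrite mulrDr.
rewrite big_split /= [X in _ + X](reindex_inj (inv_inj (flipK i))) /= -big_split /=.
apply: eq_bigr => c _; rewrite flipK.
have [->|nz] := eqVneq (hemis (decr a i) c) 0; first by rewrite !mulr0 addr0.
have Kc := hemis_on_spheres aD' nz.
rewrite sg_flip // cup_flip // F2_natb -mulrDl -mulrDl addrA F2_addxx add0r mulrA //.
Qed.

Variable mx : I -> 'I_n.
Hypothesis mx_supp : forall e, supp e (mx e).
Hypothesis mx_max : forall e i, supp e i -> (i <= mx e)%N.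

Lemma weight_decr a i : (0 < a i)%N -> (\sum_(k < n) k * a k = i + \sum_(k < n) k * decr a i k)%N.
Proof.
move=> ai; rewrite (bigD1 i) //= [in RHS](bigD1 i) //= addnA /decr eqxx -mulnS prednK //.
by congr (_ + _)%N; apply: eq_bigr => k /negbTE ->.
Qed.

(** If variable [i] has weight [i], no monomial of the product weighs more than the sum of the
    largest indices. *)
Lemma coef_overweight l a : (\sum_(e <- l) mx e < \sum_(i < n) i * a i)%N -> coef l a = 0.
Proof.
elim: l a => [|e l IH] a /=.
  rewrite big_nil; case: forallP => // a0; rewrite big1 // => i _.
  by rewrite (eqP (a0 i)) muln0.
rewrite big_cons => lt; rewrite big1 // => i /andP[si ai]; apply: IH.
rewrite (weight_decr ai) in lt; have := mx_max si; lia.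
Qed.

(** Taking a variable other than the largest from the first class leaves an overweight monomial for
    the remaining classes, so only one choice contributes. *)
Lemma coef_max l a : (forall i, a i = count (fun e => mx e == i) l) -> coef l a = 1.
Proof.
elim: l a => [|e l IH] a /= ea.
  by rewrite (_ : [forall i, _]) //; apply/forallP => i; rewrite ea.
have a0 : (0 < a (mx e))%N by rewrite ea eqxx.
have ea' i : decr a (mx e) i = count (fun e => mx e == i) l.
  by rewrite /decr ea (eq_sym i); case: eqP.
rewrite (bigD1 (mx e)) /=; last by rewrite mx_supp.
rewrite IH // big1 ?addr0 // => i /andP[/andP[si ai] ie]; apply: coef_overweight.
have wl : (\sum_(i < n) i * decr a (mx e) i = \sum_(e <- l) mx e)%N.
  under [LHS]eq_bigr => k _ do rewrite ea'.
  elim: (l) => [|e' l' IHl]; first by rewrite big_nil big1 // => k _; rewrite muln0.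
  rewrite big_cons -IHl (bigD1 (mx e')) //= [in RHS](bigD1 (mx e')) //= eqxx mulnDr muln1 -!addnA.
  congr (_ + (_ + _))%N; apply: eq_bigr => k /negbTE ke; rewrite eq_sym ke //.
have := weight_decr a0; rewrite (weight_decr ai) wl.
by have := mx_max si; move: ie; rewrite -val_eqE /=; lia.
Qed.

Definition subcell (c' c : cell) := forall k j, c' k j = c k j \/
  (odd (c k j) /\ (c' k j = c k j + 1 \/ c' k j = c k j - 1)).

Lemma subcell_dir c' c j : par c j -> (c' = c + dir j \/ c' = c - dir j) -> subcell c' c.
Proof.
case: j => i0 j0 pj H k l; have [[-> ->]|kl] := eqVneq (k, l) (i0, j0).
  right; split=> //; case: H => ->; rewrite !mxE /= !eqxx; [left|right]; by [].
left; case: H => ->.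
  by rewrite mxE (dirE _ (k, l)) eq_sym (negbTE kl) addr0.
by rewrite 2!mxE (dirE _ (k, l)) eq_sym (negbTE kl) subr0.
Qed.

Lemma subcell_trans c1 c2 c3 : subcell c1 c2 -> subcell c2 c3 -> subcell c1 c3.
Proof.
move=> H12 H23 k l; case: (H23 k l) => [<-|[o3 e23]]; first exact: H12.
right; split=> //; case: (H12 k l) => [->//|[o2 _]]; exfalso; move: o2.
by case: e23 => ->; rewrite ?odd_Zq_add1 ?odd_Zq_sub1 o3.
Qed.

(** If [sg e0] had its value at [c] on every face where [cup l] is nonzero, it could be replaced by
    that constant, and [cobd_cup] would give 0. So some face [c'] has another sign and a nonzero
    [cup l]; the pair [c'], [c] serves [e0] and induction on [c'] serves the rest. *)
Lemma cup_sign_change l c e : cup l c != 0 -> e \in l ->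
  exists c1 c2, [/\ subcell c1 c, subcell c2 c & sg e c1 != sg e c2].
Proof.
elim: l c => // e0 l IH c /= nz el.
pose P (p : 'I_n * 'I_D * bool) := let c' := if p.2 then c + dir p.1 else c - dir p.1 in
  [&& par c p.1, sg e0 c' != sg e0 c & cup l c' != 0].
case: (pickP P) => [[j b] /and3P[/= pj sc nz']|none]; last first.
  have Z : \sum_j (sg e0 c)%:R * partial_op true j (cup l) c = 0.
    by rewrite -mulr_sumr -/(total_op _ _ _) cobd_cup mulr0.
  move/eqP: nz; case; rewrite -[LHS]addr0 -[X in _ + X = _]Z.
  rewrite /total_op -big_split /=; apply: big1 => j _; rewrite /partial_op.
  case: (boolP (par c j)) => pj; last by rewrite !mul0r mulr0 addr0.
  have := none (j, true); have := none (j, false); rewrite /P /= pj /= => Hm Hp.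
  have cancel (b1 b2 : bool) (x : F2) : (b1 != b2) && (x != 0) = false -> b1%:R * x + b2%:R * x = 0.
    by case: eqP => [-> _|_ /negbFE/eqP->]; rewrite ?F2_addxx // !mulr0 addr0.
  by rewrite !mul1r mulrDr addrACA !cancel ?addr0. 
have sub' : subcell (if b then c + dir j else c - dir j) c.
  by apply: (subcell_dir pj); case: b {sc nz'}; [left|right].
move: el; rewrite in_cons => /predU1P[->|el].
  exists (if b then c + dir j else c - dir j), c; split=> // k l'; by left.
have [c1 [c2 [s1 s2 ne]]] := IH _ nz' el.
by exists c1, c2; split=> //; apply: subcell_trans sub'.
Qed.
(** With as many dimensions in factor [i] as there are classes of largest index [i], the evaluation
    on the hemispheres is 1, so one of its terms is nonzero. *)
Lemma sign_change_cell l : (forall i, (count (fun e => mx e == i) l < D)%N) ->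
  exists2 c, on_spheres c & forall e, e \in l ->
    exists c1 c2, [/\ subcell c1 c, subcell c2 c & sg e c1 != sg e c2].
Proof.
move=> aD; pose a i := count (fun e => mx e == i) l.
have sz : (\sum_i a i)%N = size l.
  rewrite /a; elim: (l) => [|e l' IH] /=; first by rewrite big1.
  by rewrite big_split /= IH (bigD1 (mx e)) //= eqxx big1 // => i; rewrite eq_sym => /negbTE->.
have T1 : \sum_c cup l c * hemis a c = 1 by rewrite (cup_hemis aD sz) coef_max.
have [c nz] : exists c, cup l c * hemis a c != 0.
  case: (pickP (fun c => cup l c * hemis a c != 0)) => [c nz|z]; first by exists c.
  by move: T1; rewrite big1 // => c _; apply/eqP; rewrite -[_ == 0]negbK z.
move: nz; rewrite mulf_eq0 negb_or => /andP[nc nh].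
by exists c => [|e]; [exact: hemis_on_spheres nh|exact: cup_sign_change].
Qed.
End Parity.
End Grid.

(** * A Borsuk-Ulam theorem for products of spheres *)

Section BorsukUlam.
Variable R : realType.

Definition nrm n D (A : 'M[R]_(n, D)) : R := \sum_i \sum_j `|A i j|.

Section Coord.
Variable m : nat.
Hypothesis m_gt0 : (0 < m)%N.
Notation Zq := 'Z_((4 * m).+2).

Implicit Types x : Zq.

(** Residues above 2m stand for negative numbers, and the grid is scaled onto [-1, 1] with step
    1/(2m). *)
Definition coord (x : Zq) : R :=
  (if (val x <= 2 * m)%N then (val x)%:R else - ((4 * m).+2 - val x)%:R) / (2 * m)%:R.

Let m2_gt0 : (0 : R) < (2 * m)%:R.
Proof. by rewrite ltr0n muln_gt0. Qed.

Lemma coord_opp x : val x != (2 * m).+1 -> coord (- x) = - coord x.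
Proof.
have := Zq_lt x; rewrite /coord val_Zq_opp -mulNr => lt ne; congr (_ / _).
have [->|x0] := eqVneq (val x) 0%N; first by rewrite /= oppr0.
have [le|gt] := leqP (val x) (2 * m); first by rewrite ifF ?subKn ?(ltnW lt) //; lia.
by rewrite ifT ?opprK //; lia.
Qed.

Lemma coord_le1 x : val x != (2 * m).+1 -> `|coord x| <= 1.
Proof.
have := Zq_lt x; rewrite /coord normrM normfV (gtr0_norm m2_gt0) ler_pdivrMr // mul1r => lt ne.
by case: leqP => le; rewrite ?normrN normr_nat ler_nat //; lia.
Qed.

Lemma coord_ends x : ends x -> `|coord x| = 1.
Proof.
rewrite /coord normrM normfV (gtr0_norm m2_gt0) => /orP[] /eqP->.
  by rewrite leqnn normr_nat divff // gt_eqF.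
rewrite ifF; last by lia.
by rewrite normrN normr_nat (_ : (_ - _)%N = 2 * m)%N; [rewrite divff // gt_eqF|lia].
Qed.

Lemma coord_add1 x : odd x -> val x != (2 * m).+1 ->
  coord (x + 1) = coord x + 1 / (2 * m)%:R.
Proof.
have := Zq_lt x; rewrite /coord val_Zq_add1 -mulrDl => lt ox ne; congr (_ / _).
case: (val x =P (4 * m).+1) => e.
  have -> : (val x <= 2 * m)%N = false by lia.
  have -> : ((4 * m).+2 - val x = 1)%N by lia.
  by rewrite leq0n addNr.
have [le|gt] := leqP (val x) (2 * m).
  have -> : ((val x).+1 <= 2 * m)%N.
    rewrite ltn_neqAle le andbT.
    by apply: contraL ox => /eqP e'; rewrite [nat_of_ord x]e' oddM.
  by rewrite natr1.
have -> : ((val x).+1 <= 2 * m)%N = false by lia.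
have -> : ((4 * m).+2 - val x = ((4 * m).+2 - (val x).+1).+1)%N by lia.
by rewrite -[in RHS]natr1 opprD addrNK.
Qed.

Lemma coord_sub1 x : odd x -> val x != (2 * m).+1 ->
  coord (x - 1) = coord x - 1 / (2 * m)%:R.
Proof.
move=> ox ne; have ne' : val (- x) != (2 * m).+1.
  by have := Zq_lt x; rewrite val_Zq_opp; case: ifP; lia.
have := coord_add1 (x := - x); rewrite odd_Zq_opp => /(_ ox ne').
have ne1 : val (x - 1) != (2 * m).+1.
  by apply/eqP => e; have := odd_Zq_sub1 x; rewrite [nat_of_ord (x - 1)]e ox /= oddM.
rewrite (_ : - x + 1 = - (x - 1)); last by rewrite opprB addrC.
by rewrite !coord_opp // => /(congr1 -%R); rewrite opprD !opprK.
Qed.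

Section Mat.
Variables n D : nat.
Notation cell := 'M[Zq]_(n, D).

Definition mat (c : cell) : 'M[R]_(n, D) := map_mx coord c.

Lemma on_spheres_in (c : cell) i j : on_spheres c -> val (c i j) != (2 * m).+1.
Proof.
by move=> /forallP/(_ i)/andP[_ /forallP/(_ j)]; rewrite mxE.
Qed.

Lemma mat_flip (c : cell) i : on_spheres c -> mat (flip i c) = flip i (mat c).
Proof.
move=> Kc; apply/matrixP => k l; rewrite !mxE; case: ifP => // _.
by rewrite coord_opp // on_spheres_in.
Qed.

Lemma mat_subcell (c' c : cell) : on_spheres c -> subcell c' c ->
  nrm (mat c' - mat c) <= (n * D)%:R / (2 * m)%:R.
Proof.
move=> Kc sub; rewrite /nrm.
apply: (@le_trans _ _ (\sum_(i < n) \sum_(j < D) (1 / (2 * m)%:R))); last first.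
  by rewrite !sumr_const !card_ord -mulrnA [(D * n)%N]mulnC div1r -[X in X <= _]mulr_natl lexx.
apply: ler_sum => i _; apply: ler_sum => j _; rewrite !mxE.
have inn := on_spheres_in i j Kc; have d0 : 0 <= 1 / (2 * m)%:R :> R by rewrite divr_ge0.
case: (sub i j) => [->|[oc [] ->]]; first by rewrite subrr normr0.
  by rewrite coord_add1 // addrAC subrr add0r ger0_norm.
by rewrite coord_sub1 // addrAC subrr add0r normrN ger0_norm.
Qed.

Lemma subcell_on_spheres (c' c : cell) : on_spheres c -> subcell c' c -> on_spheres c'.
Proof.
move=> Kc sub; apply/forallP => i; have /forallP/(_ i)/andP[/existsP[j ej] _] := Kc.
have even_in (y : Zq) : ~~ odd y -> val y != (2 * m).+1.
  by apply: contraNneq => e; rewrite [nat_of_ord y]e /= oddM.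
apply/andP; split.
  apply/existsP; exists j; move: ej; rewrite !mxE.
  case: (sub i j) => [->//|[+ _]]; rewrite /ends => + /orP[] /eqP e.
    by rewrite [nat_of_ord _]e oddM.
  by rewrite [nat_of_ord _]e /= oddM.
apply/forallP => l; rewrite mxE; case: (sub i l) => [->|[oc e]]; first exact: on_spheres_in.
by apply: even_in; case: e => ->; rewrite ?odd_Zq_add1 ?odd_Zq_sub1 oc.
Qed.

Lemma mat_box (c : cell) i j : on_spheres c -> `|mat c i j| <= 1.
Proof. by move=> Kc; rewrite mxE coord_le1 // on_spheres_in. Qed.

Lemma mat_ends (c : cell) i : on_spheres c -> exists j, `|mat c i j| = 1.
Proof.
move=> /forallP/(_ i)/andP[/existsP[j ej] _]; exists j; rewrite mxE coord_ends //.
by move: ej; rewrite mxE.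
Qed.

(* An odd choice of one row in each pair [{x, -x}]. *)
Definition row_sign (x : 'rV[Zq]_D) : bool := (enum_rank x < enum_rank (- x))%N.

Lemma row_sign_opp (x : 'rV[Zq]_D) : on_sphere x -> row_sign (- x) = ~~ row_sign x.
Proof.
move=> /andP[/existsP[j ej] _]; rewrite /row_sign opprK -leqNgt [RHS]leq_eqVlt.
rewrite (_ : (_ == _) = false) //; apply/negP => /eqP /val_inj/enum_rank_inj/matrixP/(_ 0 j); rewrite mxE => e.
have := val_Zq_opp (x 0 j); rewrite e; move: ej; rewrite /ends.
by case/orP => /eqP ->; [case: ifP; lia|move=> H; have : (2 * m).+2 = ((4 * m).+2 - (2 * m).+2)%N := H; lia].
Qed.
End Mat.

Variables (n D : nat) (I : eqType) (supp : I -> pred 'I_n) (mx : I -> 'I_n).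
Hypothesis mx_supp : forall e, supp e (mx e).
Hypothesis mx_max : forall e i, supp e i -> (i <= mx e)%N.
Variable f : I -> 'M[R]_(n, D) -> R.
Hypothesis f_flip : forall e i U, f e (flip i U) = (-1) ^+ supp e i * f e U.

Definition cell_sign (e : I) (c : 'M[Zq]_(n, D)) : bool :=
  \big[addb/false]_(i | supp e i) row_sign (row i c).

(** Where [f e] is nonzero this is its sign. At a zero the tie is broken by [cell_sign], which
    changes with [supp] under flips, so that [fsign_flip] holds there too. *)
Definition fsign (e : I) (c : 'M[Zq]_(n, D)) : bool :=
  (0 <= (-1) ^+ cell_sign e c * f e (mat c)) (+) cell_sign e c.

Lemma fsign_flip e i c : on_spheres c -> fsign e (flip i c) = fsign e c (+) supp e i.
Proof.
move=> Kc; have cf : cell_sign e (flip i c) = cell_sign e c (+) supp e i.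
  rewrite /cell_sign; case si: (supp e i); last first.
    rewrite addbF; apply: eq_bigr => k sk; rewrite row_flip; case: eqP => // ki.
    by rewrite -ki sk in si.
  rewrite !(bigD1 (P := supp e) i) //= row_flip eqxx row_sign_opp; last by move/forallP: Kc.
  rewrite addbT addNb; congr (~~ (_ (+) _)).
  by apply: eq_bigr => k /andP[_ ki]; rewrite row_flip (negbTE ki).
rewrite /fsign cf mat_flip // f_flip signr_addb mulrA -(mulrA _ _ ((-1) ^+ supp e i)) -expr2 sqrr_sign mulr1.
by rewrite addbA.
Qed.

Lemma fsignP e c : if fsign e c then 0 <= f e (mat c) else f e (mat c) <= 0.
Proof.
rewrite /fsign; case: (cell_sign e c); rewrite ?mul1r ?mulN1r ?addbF //=.
  by rewrite addbT oppr_ge0; case: leP => // /ltW.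
by case: leP => // /ltW.
Qed.
End Coord.

(** The mesh is chosen so that [f e] varies by at most [eps] between a cell and its subcells. On the
    cell given by [sign_change_cell], every [f e] takes values of both signs on subcells, hence is
    small on the cell. *)
Theorem odd_maps_approx_zero (n D : nat) (I : eqType) (supp : I -> pred 'I_n)
    (mx : I -> 'I_n) (f : I -> 'M[R]_(n, D) -> R) (l : seq I) (K eps : R) :
  (forall e, supp e (mx e)) -> (forall e i, supp e i -> (i <= mx e)%N) ->
  (forall i, (count (fun e => mx e == i) l < D)%N) ->
  (forall e i U, f e (flip i U) = (-1) ^+ supp e i * f e U) ->
  (forall e (U V : 'M[R]_(n, D)), (forall i j, `|U i j| <= 1) -> (forall i j, `|V i j| <= 1) ->
     `|f e U - f e V| <= K * nrm (U - V)) ->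
  0 < eps ->
  exists U : 'M[R]_(n, D), [/\ forall i j, `|U i j| <= 1, forall i, exists j, `|U i j| = 1
    & forall e, e \in l -> `|f e U| <= eps].
Proof.
move=> mx_supp mx_max small f_flip f_lip eps0.
pose B := `|K| * (n * D)%:R.
pose m := (Num.truncn (B / eps)).+1; have m0 : (0 < m)%N by [].
have mB : B / (2 * m)%:R <= eps.
  rewrite ler_pdivrMr ?ltr0n ?muln_gt0 // mulrC -ler_pdivrMr //.
  apply: le_trans (ltW (truncnS_gt _)) _; by rewrite ler_nat -/m leq_pmull.
have [c Kc Hc] := sign_change_cell m0 (fsign_flip m0 f_flip) mx_supp mx_max small.
exists (mat c); split=> [i j|i|e el]; [exact: mat_box|exact: mat_ends|].
have [c1 [c2 [s1 s2 ne]]] := Hc e el.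
have close c' : subcell c' c -> `|f e (mat c') - f e (mat c)| <= eps.
  move=> sub; have K' := subcell_on_spheres Kc sub.
  apply: le_trans (f_lip _ _ _ _ _) _; try by move=> i j; exact: mat_box.
  apply: le_trans mB; rewrite /B -mulrA.
  apply: le_trans (ler_wpM2l (normr_ge0 K) (mat_subcell m0 Kc sub)).
  by apply: ler_wpM2r (ler_norm K); rewrite /nrm; do 2 apply: sumr_ge0 => ? _.
have zero_between (a b x : R) : `|a - x| <= eps -> `|b - x| <= eps ->
    0 <= a -> b <= 0 -> `|x| <= eps.
  by rewrite !ler_norml; lra.
have := fsignP supp f e c1; have := fsignP supp f e c2.
move: ne; case: (fsign _ _ e c1); case: (fsign _ _ e c2) => // _.
  by move=> b a; exact: zero_between (close _ s1) (close _ s2) a b.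
by move=> a b; exact: zero_between (close _ s2) (close _ s1) a b.
Qed.
End BorsukUlam.

(** * Domination by a sublinear function *)

Section Separation.
Variables (R : realType) (n : nat) (psi : 'rV[R]_n -> R).
Hypothesis psi0 : psi 0 = 0.
Hypothesis psiZ : forall (t : R) w, 0 < t -> psi (t *: w) = t * psi w.
Hypothesis psi_small : forall N (w : 'I_N -> 'rV[R]_n),
  (N <= n.+1)%N -> \sum_i w i = 0 -> 0 <= \sum_i psi (w i).

(** More than n + 1 vectors, each extended by its value under [psi], are linearly dependent.
    Subtracting the multiple of the relation that first makes a coefficient vanish keeps all
    coefficients nonnegative and both sums unchanged, and removes a vector. *)
Lemma caratheodory_zero_sum N (w : 'I_N -> 'rV[R]_n) : \sum_i w i = 0 -> 0 <= \sum_i psi (w i).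
Proof.
elim: N w => [|N IH] w w0; first exact: psi_small.
have [le|gt] := leqP N.+1 n.+1; first exact: psi_small.
pose A : 'M[R]_(N.+1, n + 1) := \matrix_i row_mx (w i) (psi (w i))%:M.
have [al al0 alA] : exists2 al : 'rV[R]_N.+1, al != 0 & al *m A = 0.
  have : kermx A != 0.
    rewrite kermx_eq0 /row_free neq_ltn (leq_ltn_trans (rank_leq_col A)) //.
    by rewrite addn1.
  by case/rowV0Pn => al /sub_kermxP alA al0; exists al.
wlog [i0 i0P] : al al0 alA / exists i, 0 < al 0 i.
  move=> H; have [i0 i0P] : exists i, al 0 i != 0.
    by apply: contrapT => /forallNP z; case/eqP: al0; apply/rowP => i; rewrite mxE; apply/eqP; apply: contrapT => /negP; exact: z.
  have [pos|neg|e] := ltgtP 0 (al 0 i0); last by rewrite -e eqxx in i0P.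
    by apply: (H al) => //; exists i0.
  by apply: (H (- al)); rewrite ?oppr_eq0 // ?mulNmx ?alA ?oppr0 //; exists i0; rewrite mxE oppr_gt0.
have alw : \sum_i al 0 i *: w i = 0 /\ \sum_i al 0 i * psi (w i) = 0.
  have eA : al *m A = row_mx (\sum_i al 0 i *: w i) (\sum_i al 0 i * psi (w i))%:M.
    rewrite mulmx_sum_row; apply/rowP => j; rewrite summxE.
    rewrite -[j]splitK; case: (split j) => k /=; rewrite ?row_mxEl ?row_mxEr ?mxE ?summxE.
      by apply: eq_bigr => i _; rewrite mxE [row i A _ _]mxE mxE row_mxEl [RHS]mxE.
    rewrite (ord1 k) mulr1n; apply: eq_bigr => i _.
    by rewrite mxE [row i A _ _]mxE mxE row_mxEr mxE mulr1n.
  have := alA; rewrite eA -row_mx0 => /eq_row_mx[-> /(congr1 (fun B : 'M_1 => B 0 0))].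
  by rewrite !mxE mulr1n.
pose im := [arg max_(i > i0) al 0 i]%O.
have imP i : al 0 i <= al 0 im by rewrite /im; case: arg_maxP => // k _; exact.
have a0 : 0 < al 0 im := lt_le_trans i0P (imP i0).
pose la i := 1 - al 0 i / al 0 im.
have la0 i : 0 <= la i by rewrite subr_ge0 ler_pdivrMr // mul1r.
have psiZ' i : psi (la i *: w i) = la i * psi (w i).
  have [->|ne] := eqVneq (la i) 0; first by rewrite scale0r mul0r.
  by rewrite psiZ // lt_neqAle eq_sym ne la0.
have lam : la im = 0 by rewrite /la divff ?subrr // gt_eqF.
have -> : \sum_i psi (w i) = \sum_i psi (la i *: w i).
  under [RHS]eq_bigr => i _ do rewrite psiZ' mulrBl mul1r mulrAC.
  by rewrite sumrB -mulr_suml alw.2 mul0r subr0.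
have laS : \sum_i la i *: w i = 0.
  under eq_bigr => i _ do rewrite scalerBl scale1r mulrC -scalerA.
  by rewrite sumrB -scaler_sumr alw.1 w0 scaler0 subr0.
rewrite (bigD1_ord im) //= lam scale0r psi0 add0r; apply: IH.
by move: laS; rewrite (bigD1_ord im) //= lam scale0r add0r.
Qed.

Definition dotr (c w : 'rV[R]_n) : R := \sum_i c 0 i * w 0 i.

(** The convex cone generated by the epigraph of [psi], as [psi] itself need not be convex. *)
Definition epi (w : 'rV[R]_n) (b : R) : Prop :=
  exists s : seq 'rV[R]_n, \sum_(v <- s) v = w /\ \sum_(v <- s) psi v <= b.

Lemma epi0 b : epi 0 b -> 0 <= b.
Proof.
case=> s [s0]; apply: le_trans; rewrite big_tnth; apply: caratheodory_zero_sum.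
by rewrite -(big_tnth _ _ s xpredT id).
Qed.

Lemma epiD w b w' b' : epi w b -> epi w' b' -> epi (w + w') (b + b').
Proof.
case=> s [<- sb] [s' [<- sb']]; exists (s ++ s'); rewrite !big_cat; split=> //.
exact: lerD.
Qed.

Lemma epiZ t w b : 0 < t -> epi w b -> epi (t *: w) (t * b).
Proof.
move=> t0 [s [<- sb]]; exists (map ( *:%R t) s); rewrite !big_map -scaler_sumr; split=> //.
under eq_bigr => v _ do rewrite psiZ //.
by rewrite -mulr_sumr ler_pM2l.
Qed.

Lemma epi_psi w : epi w (psi w).
Proof. by exists [:: w]; rewrite !big_seq1. Qed.

Lemma dotrDr c w w' : dotr c (w + w') = dotr c w + dotr c w'.
Proof. by rewrite -big_split; apply: eq_bigr => i _; rewrite mxE mulrDr. Qed.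

Lemma dotrZr c t w : dotr c (t *: w) = t * dotr c w.
Proof. by rewrite mulr_sumr; apply: eq_bigr => i _; rewrite mxE mulrCA. Qed.

(** Hahn-Banach one coordinate at a time. Points of the cone with [J]-th coordinate -1 bound the new
    coefficient from below, those with coordinate 1 from above; adding one of each kind and using
    the induction hypothesis shows the bounds compatible, and the supremum of the lower ones is
    taken. *)
Lemma partial_functional j : (j <= n)%N -> exists c : 'rV[R]_n, forall (w : 'rV[R]_n) b,
  (forall i : 'I_n, (j <= i)%N -> w 0 i = 0) -> epi w b -> dotr c w <= b.
Proof.
elim: j => [|j IH] jn.
  exists 0 => w b w0 eb; have -> : dotr 0 w = 0 by apply: big1 => i _; rewrite mxE mul0r.
  by apply: epi0; rewrite -(_ : w = 0) //; apply/rowP => i; rewrite mxE w0.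
have [c cP] := IH (ltnW jn); pose J := Ordinal jn.
pose tail0 (w : 'rV[R]_n) := forall i : 'I_n, (j < i)%N -> w 0 i = 0.
pose S : set R := fun x => exists w b, [/\ tail0 w, w 0 J = -1, epi w b & x = dotr c w - b].
have ub w b : tail0 w -> w 0 J = 1 -> epi w b -> ubound S (b - dotr c w).
  move=> w0 wJ eb _ [w' [b' [w'0 w'J eb' ->]]].
  rewrite lerBlDr addrAC lerBrDr -dotrDr addrC; apply: cP (epiD _ _) => // i.
  rewrite leq_eqVlt => /predU1P[ij|ij]; rewrite mxE; last by rewrite w0 // w'0 // addr0.
  by rewrite (_ : i = J) ?wJ ?w'J ?addNr ?subrr //; exact/val_inj.
have tailJ (t : R) : tail0 (t *: delta_mx 0 J).
  by move=> i ij; rewrite !mxE -[i == J]/(i == j :> nat) gtn_eqF // andbF mulr0.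
have S0 : (S !=set0)%classic.
  exists (dotr c (- 1 *: delta_mx 0 J) - psi (- 1 *: delta_mx 0 J)).
  exists (- 1 *: delta_mx 0 J), (psi (- 1 *: delta_mx 0 J)); split=> //.
    by rewrite !mxE !eqxx mulr1.
  exact: epi_psi.
have Sub : has_ubound S.
  exists (psi (1 *: delta_mx 0 J) - dotr c (1 *: delta_mx 0 J)); apply: ub => //.
    by rewrite !mxE !eqxx mulr1.
  exact: epi_psi.
exists (c + (sup S) *: delta_mx 0 J) => w b w0 eb.
have -> : dotr (c + sup S *: delta_mx 0 J) w = dotr c w + sup S * w 0 J.
  rewrite /dotr [in X in _ = _ + X](_ : w 0 J = \sum_i (i == J)%:R * w 0 i).
    by rewrite mulr_sumr -big_split; apply: eq_bigr => i _; rewrite !mxE /= mulrDl mulrA.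
  by rewrite (bigD1 J) //= eqxx mul1r big1 ?addr0 // => i /negbTE->; rewrite mul0r.
have [t0|t0|t0] := ltgtP (w 0 J) 0.
- have u0 : 0 < (- w 0 J)^-1 by rewrite invr_gt0 oppr_gt0.
  have : dotr c ((- w 0 J)^-1 *: w) - (- w 0 J)^-1 * b <= sup S.
    apply: (ub_le_sup Sub); exists ((- w 0 J)^-1 *: w), ((- w 0 J)^-1 * b); split=> //.
    + by move=> i ij; rewrite mxE (w0 i) // mulr0.
    + by rewrite mxE invrN mulNr mulVf // lt_eqF.
    + exact: epiZ.
  rewrite dotrZr -mulrBr ler_pdivrMl ?oppr_gt0 // mulNr; lra.
- have u0 : 0 < (w 0 J)^-1 by rewrite invr_gt0.
  have : sup S <= (w 0 J)^-1 * b - dotr c ((w 0 J)^-1 *: w).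
    apply: ge_sup => //; apply: ub; last exact: epiZ.
    + by move=> i ij; rewrite mxE (w0 i) // mulr0.
    + by rewrite mxE mulVf // gt_eqF.
  rewrite dotrZr -mulrBr ler_pdivlMl //; lra.
- rewrite t0 mulr0 addr0; apply: cP => // i; rewrite leq_eqVlt => /predU1P[ij|]; last exact: w0.
  by rewrite (_ : i = J) //; exact/val_inj.
Qed.

Theorem exists_dominated_functional : exists c, forall w, dotr c w <= psi w.
Proof.
have [c cP] := partial_functional (leqnn n).
by exists c => w; apply: cP (epi_psi w) => i; rewrite leqNgt ltn_ord.
Qed.
End Separation.

(** * Common centers *)

Section Norm.
Variable R : realType.

Lemma nrm_ge0 n D (A : 'M[R]_(n, D)) : 0 <= nrm A.
Proof. by do 2 apply: sumr_ge0 => ? _. Qed.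

Lemma nrmD n D (A B : 'M[R]_(n, D)) : nrm (A + B) <= nrm A + nrm B.
Proof.
rewrite /nrm -big_split; apply: ler_sum => i _; rewrite -big_split.
by apply: ler_sum => j _; rewrite mxE ler_normD.
Qed.

Lemma nrmN n D (A : 'M[R]_(n, D)) : nrm (- A) = nrm A.
Proof. by apply: eq_bigr => i _; apply: eq_bigr => j _; rewrite mxE normrN. Qed.

Lemma nrmM n D (w : 'rV[R]_n) (A : 'M[R]_(n, D)) : nrm (w *m A) <= nrm w * nrm A.
Proof.
rewrite /nrm !big_ord1.
apply: (@le_trans _ _ (\sum_(j < D) \sum_(i < n) `|w 0 i| * `|A i j|)).
  apply: ler_sum => j _; rewrite mxE; apply: le_trans (ler_norm_sum _ _ _) _.
  by apply: ler_sum => i _; rewrite normrM.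
rewrite exchange_big mulr_suml; apply: ler_sum => i _ /=; rewrite -mulr_sumr.
apply: ler_wpM2l => //; rewrite [leRHS](bigD1 i) //= lerDl.
by do 2 apply: sumr_ge0 => ? _.
Qed.

Lemma nrm_flip n D i (A : 'M[R]_(n, D)) : nrm (flip i A) = nrm A.
Proof.
by apply: eq_bigr => k _; apply: eq_bigr => j _; rewrite mxE; case: ifP => // _; rewrite normrN.
Qed.

Lemma flipB n D i (A B : 'M[R]_(n, D)) : flip i (A - B) = flip i A - flip i B.
Proof. by apply/matrixP => k l; rewrite !mxE; case: ifP => // _; rewrite opprB opprK addrC. Qed.

Lemma dotr_le n (c w : 'rV[R]_n) b : (forall i, `|c 0 i| <= b) -> dotr c w <= b * nrm w.
Proof.
move=> cb; rewrite /nrm big_ord1 mulr_sumr; apply: ler_sum => i _.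
by apply: le_trans (ler_norm _) _; rewrite normrM ler_wpM2r.
Qed.

Lemma finite_net n D (tau : R) : 0 < tau ->
  exists (T : finType) (v : T -> 'M[R]_(n, D)),
    forall U : 'M[R]_(n, D), (forall i j, `|U i j| <= 1) -> exists q, nrm (U - v q) <= tau.
Proof.
move=> tau0; pose Q := (Num.truncn ((n * D)%:R / tau)).+1.
have Q0 : 0 < Q%:R :> R by rewrite ltr0n.
have bnd : (n * D)%:R / Q%:R <= tau.
  by rewrite ler_pdivrMr // mulrC -ler_pdivrMr // ltW // truncnS_gt.
exists 'M['I_(Q.*2.+1)]_(n, D), (fun q : 'M['I_(Q.*2.+1)]_(n, D) => \matrix_(i, j) ((q i j)%:R / Q%:R - 1)) => U Ub.
exists (\matrix_(i, j) inord (Num.truncn ((U i j + 1) * Q%:R))).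
apply: le_trans bnd; rewrite /nrm.
apply: (@le_trans _ _ (\sum_(i < n) \sum_(j < D) (Q%:R^-1))); last first.
  by rewrite !sumr_const !card_ord -mulrnA [(D * n)%N]mulnC -[X in X <= _]mulr_natl lexx.
apply: ler_sum => i _; apply: ler_sum => j _; rewrite !mxE.
have := Ub i j; rewrite ler_norml => /andP[lo hi].
set x := (U i j + 1) * Q%:R; have x0 : 0 <= x by apply: mulr_ge0; [move: lo; lra|exact: ltW].
have xQ : x <= (Q.*2)%:R.
  by rewrite -muln2 natrM [leRHS]mulrC /x ler_wpM2r ?(ltW Q0) //; move: hi; lra.
rewrite inordK; last first.
  by rewrite ltnS -(ler_nat R); apply: le_trans xQ; rewrite truncn_le.
have -> : U i j - ((Num.truncn x)%:R / Q%:R - 1) = (x - (Num.truncn x)%:R) / Q%:R.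
  by rewrite mulrBl /x mulfK ?gt_eqF //; ring.
rewrite normrM normfV (gtr0_norm Q0) -[leRHS]mul1r ler_wpM2r ?invr_ge0 ?(ltW Q0) //.
have := truncn_le x; have := truncnS_gt x; rewrite x0 -natr1 => h1 h2.
by rewrite ger0_norm; lra.
Qed.
End Norm.

(** * Centers on a finite net symmetric under sign changes of rows *)

Section Selection.
Variables (R : realType) (n k d : nat) (phi : 'I_k -> 'rV[R]_d -> R).
Hypothesis phi0 : forall i, phi i 0 = 0.
Hypothesis phiZ : forall i (t : R) (a : 'rV[R]_d), 0 < t -> phi i (t *: a) = t * phi i a.
Hypothesis phi_small : forall i N (a : 'I_N -> 'rV[R]_d),
  (N <= n.+1)%N -> \sum_j a j = 0 -> 0 <= \sum_j phi i (a j).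

Lemma exists_center i (U : 'M[R]_(n, d)) : exists c, forall w, dotr c w <= phi i (w *m U).
Proof.
apply: (@exists_dominated_functional R n (fun w => phi i (w *m U))).
- by rewrite mul0mx.
- by move=> t w t0; rewrite -scalemxAl phiZ.
- move=> N w le w0; apply: (phi_small i (a := fun j => w j *m U)) => //.
  by rewrite -mulmx_suml w0 mul0mx.
Qed.

Definition negc (i : 'I_n) (c : 'rV[R]_n) : 'rV[R]_n :=
  \row_x if x == i then - c 0 x else c 0 x.

(** Every net point is paired with all sign vectors, which multiply the rows of its location and the
    coordinates of its center alike. Flips then act on the net, and the choice of centers is
    equivariant by construction. *)
Lemma symmetric_net (tau : R) : 0 < tau ->
  exists (T : finType) (loc : T -> 'M[R]_(n, d)) (ctr : 'I_k -> T -> 'rV[R]_n) (fl : 'I_n -> T -> T),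
    [/\ forall i, involutive (fl i),
        forall i p, loc (fl i p) = flip i (loc p) /\ forall j, ctr j (fl i p) = negc i (ctr j p),
        forall U : 'M[R]_(n, d), (forall i j, `|U i j| <= 1) -> exists p, nrm (U - loc p) <= tau
      & forall j p w, dotr (ctr j p) w <= phi j (w *m loc p)].
Proof.
move=> /(finite_net n d)[T [v net]].
have [c cP] : {c : 'I_k -> T -> 'rV[R]_n | forall j q w, dotr (c j q) w <= phi j (w *m v q)}.
  exists (fun j q => projT1 (cid (exists_center j (v q)))) => j q.
  exact: (projT2 (cid (exists_center j (v q)))).
pose fl (i : 'I_n) (p : T * {ffun 'I_n -> bool}) := (p.1, [ffun x => p.2 x (+) (x == i)]).
exists (T * {ffun 'I_n -> bool})%type.
exists (fun p : T * {ffun 'I_n -> bool} => \matrix_(i, j) ((-1) ^+ p.2 i * v p.1 i j)).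
exists (fun j (p : T * {ffun 'I_n -> bool}) => \row_x ((-1) ^+ p.2 x * c j p.1 0 x)), fl; split.
- by move=> i [q s]; congr pair; apply/ffunP => x; rewrite !ffunE addbK.
- move=> i [q s]; split=> [|j]; apply/matrixP => x y; rewrite !mxE ?ffunE ?(ord1 x);
    by case: eqP => _; rewrite ?addbF // addbT signrN mulNr.
- move=> U /net[q qP]; exists (q, [ffun=> false]).
  suff -> : \matrix_(i, j) ((-1) ^+ [ffun=> false] i * v q i j) = v q by [].
  by apply/matrixP => i j; rewrite mxE ffunE mul1r.
- move=> j [q s] w /=; pose w' : 'rV[R]_n := \row_x ((-1) ^+ s x * w 0 x).
  have := cP j q w'; congr (_ <= phi j _).
    by apply: eq_bigr => x _; rewrite !mxE mulrCA mulrA.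
  by apply/rowP => y; rewrite !mxE; apply: eq_bigr => x _; rewrite !mxE mulrCA mulrA.
Qed.
End Selection.

(** * Approximate coincidence of the centers *)

Section ApproximateCenter.
Variables (R : realType) (n k d : nat).
Hypothesis d_eq : d = (n + k)%N.

Section Equations.
Variables (T : finType) (loc : T -> 'M[R]_(n, d)) (ctr : 'I_k.+1 -> T -> 'rV[R]_n).
Variables (fl : 'I_n -> T -> T) (tau : R).
Hypothesis flI : forall i, involutive (fl i).
Hypothesis loc_fl : forall i p, loc (fl i p) = flip i (loc p).
Hypothesis ctr_fl : forall i p j, ctr j (fl i p) = negc i (ctr j p).

(** A tent function of radius [tau]; divided by their sum, these form the partition of unity. *)
Definition weight (p : T) (U : 'M[R]_(n, d)) : R := Num.max 0 (tau - nrm (U - loc p)).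

Lemma weight_ge0 p U : 0 <= weight p U.
Proof. by rewrite le_max lexx. Qed.

Lemma weight_fl i p U : weight (fl i p) (flip i U) = weight p U.
Proof. by rewrite /weight loc_fl -flipB nrm_flip. Qed.

Lemma weight_lip p U V : `|weight p U - weight p V| <= nrm (U - V).
Proof.
have tri A B : nrm (A - loc p) <= nrm (B - loc p) + nrm (A - B).
  have -> : A - loc p = (A - B) + (B - loc p) by rewrite addrA subrK.
  by rewrite addrC nrmD.
have := tri U V; have := tri V U; rewrite -(nrmN (V - U)) opprB.
have := nrm_ge0 (U - V); rewrite /weight ler_norml.
by case: (lerP 0 (tau - nrm (U - loc p))); case: (lerP 0 (tau - nrm (V - loc p))); lra.
Qed.

(* The difference of two weighted averages of centers, without the common
   positive denominator. *)
Definition center_diff (j : 'I_k.+1) (i : 'I_n) (U : 'M[R]_(n, d)) : R :=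
  \sum_p weight p U * (ctr j p 0 i - ctr ord0 p 0 i).

Lemma center_diff_flip j i y U : center_diff j i (flip y U) = (-1) ^+ (i == y) * center_diff j i U.
Proof.
rewrite /center_diff (reindex_inj (inv_inj (flI y))) mulr_sumr; apply: eq_bigr => p _ /=.
rewrite weight_fl !ctr_fl !mxE mulrCA; case: eqP => _; last by rewrite mul1r.
by rewrite mulN1r opprB opprK addrC.
Qed.

Definition row_prod (x y : 'I_n) (U : 'M[R]_(n, d)) : R := \sum_j U x j * U y j.

Lemma row_prod_flip x y i U : row_prod x y (flip i U) = (-1) ^+ ((x == i) (+) (y == i)) * row_prod x y U.
Proof.
rewrite mulr_sumr; apply: eq_bigr => j _; rewrite !mxE signr_addb.
by case: eqP => _; case: eqP => _; rewrite ?expr0 ?expr1; ring.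
Qed.

Lemma row_prod_lip x y (U V : 'M[R]_(n, d)) : (forall i j, `|U i j| <= 1) -> (forall i j, `|V i j| <= 1) ->
  `|row_prod x y U - row_prod x y V| <= 2 * nrm (U - V).
Proof.
move=> Ub Vb; rewrite /row_prod -sumrB.
have row_le (z : 'I_n) : \sum_j `|(U - V) z j| <= nrm (U - V).
  by rewrite /nrm (bigD1 z) //= lerDl; do 2 apply: sumr_ge0 => ? _.
apply: le_trans (ler_norm_sum _ _ _) _.
apply: le_trans (_ : _ <= \sum_j `|(U - V) x j| + \sum_j `|(U - V) y j|) _; last first.
  by rewrite mulr2n mulrDl mul1r lerD.
rewrite -big_split; apply: ler_sum => j _ /=; rewrite !mxE.
have -> : U x j * U y j - V x j * V y j = (U x j - V x j) * U y j + V x j * (U y j - V y j) by ring.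
apply: le_trans (ler_normD _ _) _; rewrite !normrM.
have h1 := ler_wpM2l (normr_ge0 (U x j - V x j)) (Ub y j).
have h2 := ler_wpM2r (normr_ge0 (U y j - V y j)) (Vb x j).
by lra.
Qed.

Definition eqn : eqType := ('I_n * 'I_d)%type.

(* The equation [(i, j)] says for [j < k] that the [i]-th coordinates of the
   centers [j + 1] and [0] agree, and for [j = k + x] with [x < i] that the rows
   [x] and [i] are orthogonal. *)
Definition orth_idx (e : eqn) (x : 'I_n) : bool := (e.2 == k + x :> nat)%N && (x < e.1)%N.

Definition eqn_supp (e : eqn) : pred 'I_n := fun x => (x == e.1) || orth_idx e x.

(** By [orth_idx_inj] the sum has at most one term; it is empty, and the equation void, when [j - k]
    is not below [i]. *)
Definition eqn_fun (e : eqn) (U : 'M[R]_(n, d)) : R :=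
  if (e.2 < k)%N then center_diff (inord e.2.+1) e.1 U
  else \sum_(x | orth_idx e x) row_prod x e.1 U.

Lemma orth_idx_inj e x y : orth_idx e x -> orth_idx e y -> x = y.
Proof.
by move=> /andP[/eqP ex _] /andP[/eqP ey _]; apply/val_inj/eqP; rewrite -(eqn_add2l k) -ex -ey.
Qed.

Lemma eqn_fun_flip e i U : eqn_fun e (flip i U) = (-1) ^+ eqn_supp e i * eqn_fun e U.
Proof.
rewrite /eqn_fun /eqn_supp; case: ltnP => ek.
  rewrite center_diff_flip eq_sym /orth_idx [X in X && _](_ : _ = false) ?orbF //.
  by apply/eqP; lia.
rewrite mulr_sumr; apply: eq_bigr => x ex; rewrite row_prod_flip; congr (_ ^+ _ * _).
have -> : orth_idx e i = (x == i).
  by apply/idP/eqP => [ei|<-//]; exact: orth_idx_inj ex ei.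
rewrite (eq_sym e.1); have [->|xi] := eqVneq i e.1; last by case: (x == i).
suff -> : (x == e.1) = false by [].
by apply/eqP => xe; move: ex; rewrite /orth_idx xe ltnn andbF.
Qed.

Definition eqn_lip : R :=
  2 * n%:R + \sum_j \sum_i \sum_p `|ctr j p 0 i - ctr ord0 p 0 i|.

Lemma eqn_fun_lip e (U V : 'M[R]_(n, d)) : (forall i j, `|U i j| <= 1) -> (forall i j, `|V i j| <= 1) ->
  `|eqn_fun e U - eqn_fun e V| <= eqn_lip * nrm (U - V).
Proof.
move=> Ub Vb; have N0 := nrm_ge0 (U - V).
have S0 : 0 <= \sum_j \sum_i \sum_p `|ctr j p 0 i - ctr ord0 p 0 i| by do 3 apply: sumr_ge0 => ? _.
rewrite /eqn_fun /eqn_lip mulrDl; case: ifP => _.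
  apply: le_trans (_ : _ <= (\sum_p `|ctr (inord e.2.+1) p 0 e.1 - ctr ord0 p 0 e.1|) * nrm (U - V)) _.
    rewrite /center_diff -sumrB mulr_suml; apply: le_trans (ler_norm_sum _ _ _) _.
    apply: ler_sum => p _; rewrite -mulrBl normrM mulrC.
    by apply: ler_wpM2l => //; exact: weight_lip.
  apply: le_trans (_ : _ <= (\sum_j \sum_i \sum_p `|ctr j p 0 i - ctr ord0 p 0 i|) * nrm (U - V)) _.
    apply: ler_wpM2r => //; rewrite (bigD1 (inord e.2.+1)) //= (bigD1 e.1) //= -addrA lerDl.
    by apply: addr_ge0; do ?[apply: sumr_ge0 => ? _].
  by rewrite lerDr !mulr_ge0.
rewrite -sumrB; apply: le_trans (ler_norm_sum _ _ _) _.
apply: le_trans (_ : _ <= \sum_(x | orth_idx e x) (2 * nrm (U - V))) _.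
  by apply: ler_sum => x _; exact: row_prod_lip.
apply: le_trans (_ : _ <= \sum_(x < n) (2 * nrm (U - V))) _.
  rewrite big_mkcond; apply: ler_sum => x _; case: ifP => // _; exact: mulr_ge0.
rewrite sumr_const card_ord -[X in X <= _]mulr_natr [X in X <= _]mulrAC lerDl; exact: mulr_ge0.
Qed.

(** In [l], row [i] leads k + i equations: [k] compare the k + 1 centers and [i] demand
    orthogonality to the earlier rows. Since k + i < d, the sphere of row [i] is large enough. *)
Lemma eqn_approx_zero (eps : R) : 0 < eps ->
  exists U : 'M[R]_(n, d), [/\ forall i j, `|U i j| <= 1, forall i, exists j, `|U i j| = 1,
    forall x y, x != y -> `|row_prod x y U| <= eps
  & forall j i, `|center_diff j i U| <= eps].
Proof.
move=> eps0; pose l : seq eqn := [seq e : 'I_n * 'I_d <- enum {: 'I_n * 'I_d} | (e.2 < k + e.1)%N].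
have small i : (count (fun e : eqn => e.1 == i) l < d)%N.
  have le_d : (k + i <= d)%N by have := ltn_ord i; lia.
  apply: (@leq_ltn_trans (k + i)); last by have := ltn_ord i; lia.
  rewrite /l count_filter -size_filter.
  set s := [seq _ <- _ | _]; have us : uniq s by rewrite filter_uniq ?enum_uniq.
  rewrite -[leqRHS]card_ord -(card_uniqP us).
  apply: leq_trans _ (leq_imset_card (fun j : 'I_(k + i) => (i, widen_ord le_d j)) predT).
  apply: subset_leq_card; apply/fintype.subsetP => -[x j]; rewrite mem_filter /= => /andP[/andP[/eqP-> jk] _].
  by apply/imsetP; exists (Ordinal jk) => //; congr pair; exact/val_inj.
have supp_max e : eqn_supp e e.1 by rewrite /eqn_supp eqxx.
have max_supp e i : eqn_supp e i -> (i <= e.1)%N by move=> /predU1P[->//|/andP[_ /ltnW]].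
have [U [Ub Ue Uz]] := odd_maps_approx_zero supp_max max_supp small eqn_fun_flip eqn_fun_lip eps0.
exists U; split=> // [x y|j i].
  wlog xy : x y / (x < y)%N.
    move=> H xy; have [lt|gt|/val_inj e] := ltngtP x y; [exact: H| |by rewrite e eqxx in xy].
    rewrite (_ : row_prod x y U = row_prod y x U); first by apply: H; rewrite // eq_sym.
    by apply: eq_bigr => j _; rewrite mulrC.
  move=> _; have jd : (k + x < d)%N by have := ltn_ord x; lia.
  have := Uz (y, Ordinal jd); rewrite mem_filter mem_enum /= ltn_add2l xy andbT => /(_ isT).
  rewrite /eqn_fun /= ltnNge leq_addr /= (big_pred1 x) // => z.
  by rewrite /orth_idx /= eqn_add2l eq_sym -val_eqE /=; case: eqP => // ->.
have [->|j0] := eqVneq j ord0.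
  by rewrite /center_diff big1 ?normr0 ?ltW // => p _; rewrite subrr mulr0.
have jk : (j.-1 < k)%N by have := ltn_ord j; move: j0; rewrite -val_eqE /=; lia.
have jd : (j.-1 < d)%N by have := ltn_ord i; lia.
have := Uz (i, Ordinal jd); rewrite mem_filter mem_enum /= andbT (leq_trans jk) ?leq_addr // => /(_ isT).
rewrite /eqn_fun /= jk prednK ?inord_val // lt0n.
by move: j0; rewrite -val_eqE.
Qed.
End Equations.

Variable phi : 'I_k.+1 -> 'rV[R]_d -> R.
Hypothesis phi0 : forall i, phi i 0 = 0.
Hypothesis phiZ : forall i (t : R) (a : 'rV[R]_d), 0 < t -> phi i (t *: a) = t * phi i a.
Hypothesis phi_small : forall i N (a : 'I_N -> 'rV[R]_d),
  (N <= n.+1)%N -> \sum_j a j = 0 -> 0 <= \sum_j phi i (a j).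
Variable r : R.
Hypothesis r_ge0 : 0 <= r.
Hypothesis phi_lip : forall i a b, phi i (a + b) <= phi i a + r * nrm b.

(** The average of the centers of function 0 serves all [i]. Half of the error comes from moving the
    net points near [U] to [U], the other half from [center_diff]. *)
Lemma approx_common_center (eps : R) : 0 < eps ->
  exists (U : 'M[R]_(n, d)) (c : 'rV[R]_n), [/\ forall i j, `|U i j| <= 1,
    forall i, exists j, `|U i j| = 1, forall x y, x != y -> `|row_prod x y U| <= eps
  & forall i w, dotr c w <= phi i (w *m U) + eps * nrm w].
Proof.
(* Moving a net point of positive weight to [U] costs r * tau <= eps / 2 per unit of [w]. The net
   has the finer radius tau / 2, so that some weight is at least tau / 2. *)
move=> eps0; pose tau := eps / (2 * (r + 1)).
have tau0 : 0 < tau by rewrite divr_gt0 // mulr_gt0 // ltr_wpDl.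
have t20 : 0 < tau / 2 by rewrite divr_gt0.
have [T [loc [ctr [fl [flI lc net dom]]]]] := symmetric_net phi0 phiZ phi_small t20.
(* After division by [den], which is at least tau / 2, the second bound becomes eps / 2. *)
pose eps' := Num.min eps (eps / 2 * (tau / 2)).
have eps'0 : 0 < eps' by rewrite lt_min eps0 mulr_gt0 // divr_gt0.
have [U [Ub Ue Uo Uc]] := eqn_approx_zero tau flI (fun i p => (lc i p).1) (fun i p => (lc i p).2) eps'0.
pose wt p := weight loc tau p U; pose den := \sum_p wt p.
have den_ge : tau / 2 <= den.
  have [p pP] := net U Ub; rewrite /den (bigD1 p) //=.
  apply: le_trans (_ : _ <= wt p) _; last by rewrite lerDl; apply: sumr_ge0 => q _; exact: weight_ge0.
  by rewrite /wt /weight le_max; apply/orP; right; lra.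
have den0 : 0 < den := lt_le_trans t20 den_ge.
exists U, (\row_i ((\sum_p wt p * ctr ord0 p 0 i) / den)); split=> // [x y xy|i w].
  by apply: le_trans (Uo x y xy) _; rewrite ge_min lexx.
rewrite -(ler_pM2l den0); set c := \row_i _.
have -> : den * dotr c w = \sum_p wt p * dotr (ctr i p) w - \sum_x center_diff loc ctr tau i x U * w 0 x.
  rewrite /dotr /center_diff.
  under [X in _ = X - _]eq_bigr => p _ do rewrite mulr_sumr.
  rewrite exchange_big -sumrB mulr_sumr; apply: eq_bigr => x _ /=.
  rewrite /c mxE mulrA [den * _]mulrC divfK ?gt_eqF //.
  rewrite !mulr_suml -sumrB; apply: eq_bigr => p _; rewrite -/(wt p); ring.
have h1 : \sum_p wt p * dotr (ctr i p) w <= den * (phi i (w *m U) + eps / 2 * nrm w).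
  rewrite mulr_suml; apply: ler_sum => p _.
  have [->|wp] := eqVneq (wt p) 0; first by rewrite !mul0r.
  have wp0 : 0 <= wt p := weight_ge0 loc tau p U.
  apply: ler_wpM2l => //; apply: le_trans (dom i p w) _.
  have close : nrm (U - loc p) <= tau.
    move: wp; rewrite /wt /weight; case: (lerP 0 (tau - nrm (U - loc p))) => [h _|_ /eqP//]; lra.
  have -> : w *m loc p = w *m U + w *m (loc p - U) by rewrite mulmxBr addrC subrK.
  apply: le_trans (phi_lip _ _ _) _; rewrite lerD2l.
  apply: le_trans (ler_wpM2l r_ge0 (nrmM _ _)) _.
  rewrite -(nrmN (_ - _)) opprB mulrCA mulrC; apply: ler_wpM2r; first exact: nrm_ge0.
  apply: le_trans (ler_wpM2l r_ge0 close) _.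
  have re : tau * (2 * (r + 1)) = eps by rewrite /tau divfK // gt_eqF // mulr_gt0 // ltr_wpDl.
  by lra.
have h2 : - \sum_x center_diff loc ctr tau i x U * w 0 x <= den * (eps / 2 * nrm w).
  apply: le_trans (_ : _ <= eps / 2 * (tau / 2) * nrm w) _; last first.
    rewrite (_ : eps / 2 * (tau / 2) * nrm w = tau / 2 * (eps / 2 * nrm w)); last by ring.
    by apply: ler_wpM2r => //; rewrite mulr_ge0 ?nrm_ge0 // ltW // divr_gt0.
  rewrite -sumrN; pose c' : 'rV[R]_n := \row_x (- center_diff loc ctr tau i x U).
  rewrite (_ : \sum_x _ = dotr c' w); last by apply: eq_bigr => x _; rewrite mxE mulNr.
  apply: dotr_le => x; rewrite mxE normrN; apply: le_trans (Uc i x) _.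
  by rewrite ge_min lexx orbT.
by move: h1 h2; rewrite !mulrDr; lra.
Qed.
End ApproximateCenter.

(** * Passage to the limit *)

Section JointSubsequence.
Import topology normedtype sequences numFieldNormedType.Exports.
Variable R : realType.

(** Bolzano-Weierstrass is applied to one sequence after another; [t <= g t] ensures that errors
    decreasing in the index stay small along [g]. *)
Lemma joint_subsequence (J : eqType) (s : seq J) (f : J -> nat -> R) (B : R) :
  (forall j t, `|f j t| <= B) ->
  exists2 g : nat -> nat, (forall t, (t <= g t)%N) &
    exists x : J -> R, forall j, j \in s -> forall eps, 0 < eps ->
      exists N, forall t, (N <= t)%N -> `|x j - f j (g t)| < eps.
Proof.
move=> fB; elim: s => [|j s [g gt [x xP]]]; first by exists id => //; exists (fun=> 0).
have [h hi /cvg_ex[y /= hy]] : exists2 h : nat -> nat, increasing_seq h & cvgn ((f j \o g) \o h).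
  apply: bolzano_weierstrass; exists B; split; first exact: num_real.
  by move=> M BM t _ /=; apply: le_trans (fB _ _) (ltW BM).
have ht t : (t <= h t)%N.
  elim: t => // t IH; apply: leq_ltn_trans IH _.
  by have := hi t t.+1; have := hi t.+1 t; rewrite ltnn leqnSn => h1 h2; rewrite ltnNge -leEnat h1.
exists (g \o h); first by move=> t; apply: leq_trans (ht t) (gt _).
exists (fun i => if i == j then y else x i) => i; rewrite in_cons.
case: eqP => [-> _|_ /= /xP xi] eps eps0; last first.
  by have [N NP] := xi eps eps0; exists N => t Nt; apply: NP; apply: leq_trans Nt (ht t).
have /cvgrPdist_lt/(_ eps eps0)[N _ NP] := hy.
by exists N => t Nt; exact: NP.
Qed.

End JointSubsequence.

Section Limit.
Variable R : realType.

Lemma ler_add_small (a b C : R) : (forall del, 0 < del -> a <= b + C * del) -> a <= b.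
Proof.
move=> H; apply/ler_addgt0Pr => e e0.
have C0 : 0 < `|C| + 1 by rewrite ltr_wpDl.
apply: le_trans (H (e / (`|C| + 1)) _) _; first exact: divr_gt0.
rewrite lerD2l mulrA ler_pdivrMr // mulrC; apply: ler_wpM2l; first exact: ltW.
by apply: le_trans (ler_norm C) _; rewrite lerDl.
Qed.

Variables (n k d : nat).
Hypothesis d_eq : d = (n + k)%N.
Variable phi : 'I_k.+1 -> 'rV[R]_d -> R.
Hypothesis phi0 : forall i, phi i 0 = 0.
Hypothesis phiZ : forall i (t : R) (a : 'rV[R]_d), 0 < t -> phi i (t *: a) = t * phi i a.
Hypothesis phi_small : forall i N (a : 'I_N -> 'rV[R]_d),
  (N <= n.+1)%N -> \sum_j a j = 0 -> 0 <= \sum_j phi i (a j).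
Variable r : R.
Hypothesis r_ge0 : 0 <= r.
Hypothesis phi_lip : forall i a b, phi i (a + b) <= phi i a + r * nrm b.

(** In a limit of approximate solutions the rows of [U] are exactly orthogonal. They are nonzero
    because each approximating row has an entry of absolute value 1, so [U] has full rank.
    Domination survives by the Lipschitz bound. *)
Theorem common_center : exists (U : 'M[R]_(n, d)) (c : 'rV[R]_n),
  row_free U /\ forall i w, dotr c w <= phi i (w *m U).
Proof.
pose ok (eps : R) (U : 'M[R]_(n, d)) (c : 'rV[R]_n) := [/\ forall i j, `|U i j| <= 1,
    forall i, exists j, `|U i j| = 1, forall x y, x != y -> `|row_prod x y U| <= eps
  & forall i w, dotr c w <= phi i (w *m U) + eps * nrm w].
have inv0 t : 0 < t.+1%:R^-1 :> R by rewrite invr_gt0.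
have [F FP] : exists F : nat -> 'M[R]_(n, d) * 'rV[R]_n, forall t, ok t.+1%:R^-1 (F t).1 (F t).2.
  have H t := approx_common_center d_eq phi0 phiZ phi_small r_ge0 phi_lip (inv0 t).
  have H' t : exists p : 'M[R]_(n, d) * 'rV[R]_n, ok t.+1%:R^-1 p.1 p.2.
    by have [U [c Hc]] := H t; exists (U, c).
  by have [F FP] := boolp.choice H'; exists F.
(* Domination at a signed unit vector bounds each coordinate of the center by r * (n * d) + 1; the
   entries of the matrices are at most 1. *)
pose B : R := 1 + r * (n * d)%:R + 1.
have nd0 : 0 <= r * (n * d)%:R by rewrite mulr_ge0.
pose f (j : 'I_n * 'I_d + 'I_n) t := match j with
  | inl p => (F t).1 p.1 p.2 | inr x => (F t).2 0 x end.
have fB j t : `|f j t| <= B.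
  have [Ub _ _ Ud] := FP t; case: j => [p|x] /=; first by have := Ub p.1 p.2; rewrite /B; lra.
  have nU : nrm (F t).1 <= (n * d)%:R.
    apply: le_trans (_ : _ <= \sum_(i < n) \sum_(j < d) 1) _.
      by apply: ler_sum => i _; apply: ler_sum => j _; exact: Ub.
    by rewrite !sumr_const !card_ord -mulrnA mulnC.
  have cw (s : R) : `|s| = 1 -> s * (F t).2 0 x <= B.
    move=> s1; pose w : 'rV[R]_n := s *: delta_mx 0 x.
    have nw : nrm w = 1.
      rewrite /nrm big_ord1 (bigD1 x) //= !mxE !eqxx mulr1 s1 big1 ?addr0 // => y /negbTE yx.
      by rewrite !mxE yx andbF mulr0 normr0.
    have := Ud 0 w; rewrite nw mulr1 (_ : dotr _ w = s * (F t).2 0 x); last first.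
      rewrite /dotr (bigD1 x) //= !mxE !eqxx mulr1 mulrC big1 ?addr0 // => y /negbTE yx.
      by rewrite !mxE yx andbF !mulr0.
    move=> /le_trans; apply; have := phi_lip 0 0 (w *m (F t).1); rewrite phi0 !add0r => h1.
    have h2 := ler_wpM2l r_ge0 (nrmM w (F t).1); rewrite nw mul1r in h2.
    have h3 := ler_wpM2l r_ge0 nU.
    have h4 : t.+1%:R^-1 <= 1 :> R by rewrite invf_le1 // ler1n.
    have := le_trans h1 (le_trans h2 h3); rewrite /B; move: h4; set q := _^-1; set z := r * (n * d)%:R; lra.
  have := cw 1 (normr1 _); have := cw (-1) (normrN1 _).
  by rewrite mulN1r mul1r ler_norml => lo hi; apply/andP; split; lra.
have [g gt [x xP]] := joint_subsequence (enum {: 'I_n * 'I_d + 'I_n}) fB.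
pose U : 'M[R]_(n, d) := \matrix_(i, j) x (inl (i, j)).
pose c : 'rV[R]_n := \row_i x (inr i).
have near_ok (del : R) : 0 < del -> exists U' c', [/\ ok del U' c',
    nrm (U - U') <= (n * d)%:R * del, forall i j, `|U i j - U' i j| <= del
  & forall i, `|c 0 i - c' 0 i| <= del].
  move=> del0.
  have [t [t_del t_near]] : exists t, t.+1%:R^-1 <= del /\ forall j, `|x j - f j (g t)| <= del.
    have {}xP j : exists N, forall t, (N <= t)%N -> `|x j - f j (g t)| < del.
      by apply: xP => //; rewrite mem_enum.
    have [N NP] := boolp.choice xP; pose M := \max_j N j.
    exists (maxn M (Num.truncn del^-1)); split.
      rewrite -[leRHS]invrK lef_pV2 ?posrE ?invr_gt0 //.
      by apply: le_trans (ltW (truncnS_gt _)) _; rewrite ler_nat ltnS leq_maxr.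
    by move=> j; apply/ltW/NP; rewrite leq_max /M leq_bigmax.
  have near_U i j : `|U i j - (F (g t)).1 i j| <= del by rewrite mxE; exact: (t_near (inl (i, j))).
  exists (F (g t)).1, (F (g t)).2; split=> //; last 2 first.
  - apply: le_trans (_ : _ <= \sum_(i < n) \sum_(j < d) del) _.
      by apply: ler_sum => i _; apply: ler_sum => j _; rewrite !mxE; have := near_U i j; rewrite !mxE.
    by rewrite !sumr_const !card_ord -mulrnA mulnC mulr_natl.
  - by move=> i; rewrite mxE; exact: (t_near (inr i)).
  have le_del : (g t).+1%:R^-1 <= del.
    by apply: le_trans t_del; rewrite lef_pV2 ?posrE // ler_nat ltnS.
  have [Ub Ue Uo Ud] := FP (g t); split=> // [y z yz|i w].
    exact: le_trans (Uo y z yz) le_del.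
  apply: le_trans (Ud i w) _; rewrite lerD2l; apply: ler_wpM2r => //; exact: nrm_ge0.
have Ub i j : `|U i j| <= 1.
  apply: (ler_add_small (C := 1)) => del del0.
  have [U' [c' [[Ub' _ _ _] _ near _]]] := near_ok del del0.
  have := near i j; have := Ub' i j; have := ler_normD (U i j - U' i j) (U' i j).
  by rewrite subrK; lra.
have orth y z : y != z -> row_prod y z U = 0.
  move=> yz; apply/normr0_eq0/eqP; rewrite -[_ == 0]/(`|_| == 0) eq_le normr_ge0 andbT.
  apply: (ler_add_small (C := 1 + 2 * (n * d)%:R)) => del del0.
  have [U' [c' [[Ub' _ Uo' _] nU _ _]]] := near_ok del del0.
  have := ler_normD (row_prod y z U - row_prod y z U') (row_prod y z U'); rewrite subrK.
  have := Uo' y z yz; have := row_prod_lip y z Ub Ub'; lra.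
have nz i : row_prod i i U != 0.
  have [U' [c' [[_ /(_ i)[j Uj] _ _] _ near _]]] := near_ok (1 / 2) ltac:(lra).
  have Uij : U i j != 0.
    apply: contraTneq (near i j) => ->; rewrite sub0r normrN Uj; lra.
  rewrite /row_prod psumr_neq0; last by move=> l _; exact: sqr_ge0.
  by apply/hasP; exists j; rewrite ?mem_index_enum //= lt_def mulf_neq0 //= sqr_ge0.
exists U, c; split=> [|i w].
  apply/inj_row_free => v vU; apply/rowP => i; rewrite mxE.
  have : \sum_l v 0 l * row_prod l i U = 0.
    transitivity (\sum_j (v *m U) 0 j * U i j); last by rewrite vU big1 // => j _; rewrite mxE mul0r.
    under eq_bigr => l _ do rewrite mulr_sumr.
    rewrite exchange_big; apply: eq_bigr => j _ /=; rewrite [(v *m U) 0 j]mxE mulr_suml.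
    by apply: eq_bigr => l _; rewrite mulrA.
  rewrite (bigD1 i) //= big1 => [|l li]; last by rewrite orth // mulr0.
  by rewrite addr0 => /eqP; rewrite mulf_eq0 (negbTE (nz i)) orbF => /eqP.
apply: (ler_add_small (C := (2 + r * (n * d)%:R) * nrm w)) => del del0.
have [U' [c' [[_ _ _ Ud'] nU _ nc]]] := near_ok del del0.
have cE : dotr c w = dotr c' w + dotr (c - c') w.
  rewrite -big_split; apply: eq_bigr => y _ /=.
  have -> : (c - c') 0 y = c 0 y - c' 0 y by rewrite !mxE.
  by rewrite -mulrDl addrC subrK.
have h1 : dotr (c - c') w <= del * nrm w by apply: dotr_le => y; rewrite !mxE; have := nc y; rewrite mxE.
have h2 : phi i (w *m U') <= phi i (w *m U) + r * (nrm w * ((n * d)%:R * del)).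
  rewrite (_ : U' = U + (U' - U)); last by rewrite addrC subrK.
  rewrite mulmxDr; apply: le_trans (phi_lip _ _ _) _; rewrite lerD2l; apply: ler_wpM2l => //.
  apply: le_trans (nrmM _ _) _; apply: ler_wpM2l; first exact: nrm_ge0.
  by rewrite -nrmN opprB.
have := Ud' i w; rewrite cE; lra.
Qed.
End Limit.

(** * Halfspace depth *)

Local Notation R := Rdefinitions.R.
(* Otherwise [b + b'] in an argument of type [R] is parsed as [Rplus b b']. *)
Bind Scope ring_scope with Rdefinitions.R.

Section Halfspaces.
Variable d : nat.
Implicit Types (a : 'rV[R]_d) (b : R) (x : Defs.point d).

Definition vec x : 'rV[R]_d := \row_i x i.

Definition halfspace a b : pset d := fun x => b < dotr a (vec x).

Lemma mem_In (T : eqType) (t : T) (s : seq T) : t \in s -> In t s.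
Proof. by elim: s => // u s IH; rewrite in_cons => /predU1P[->|/IH]; [left|right]. Qed.

Lemma rsumE (I : Type) (l : list I) (f : I -> R) : rsum l f = \sum_(i <- l) f i.
Proof. by elim: l => [|i l IH]; rewrite ?big_nil ?big_cons //= IH. Qed.

Lemma dotE (a x : Defs.point d) : dot a x = dotr (vec a) (vec x).
Proof. by rewrite /dot rsumE big_enum; apply: eq_bigr => i _; rewrite !mxE. Qed.

Lemma pset_ext (X Y : pset d) : set_eq X Y -> X = Y.
Proof. by move=> XY; apply/funext => x; apply/propext; exact: XY. Qed.

Lemma vecK a : vec (fun i => a 0 i) = a.
Proof. by apply/rowP => i; rewrite mxE. Qed.

Lemma open_halfspaceP h : open_halfspace h <-> exists a b, a != 0 /\ h = halfspace a b.
Proof.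
split=> [[a [b [[i ai] hE]]]|[a [b [a0 ->]]]].
  exists (vec a), b; split.
    by apply/eqP => /rowP/(_ i); rewrite !mxE; exact: ai.
  by apply: pset_ext => x; rewrite hE dotE; split=> /RltP.
exists (fun i => a 0 i), b; split.
  apply: contrapT => /forallNP z; case/eqP: a0; apply/rowP => i; rewrite mxE.
  by apply: contrapT; exact: z.
by move=> x; rewrite dotE vecK; split=> /RltP.
Qed.

Lemma halfspace_open a b : a != 0 -> open_halfspace (halfspace a b).
Proof. by move=> a0; apply/open_halfspaceP; exists a, b. Qed.

(** [H_subadditive] speaks of lists without repetition, so a cover is first cleared of repeated
    halfspaces. *)
Lemma distinct_sublist (hs : list (pset d)) : exists hs',
  [/\ distinct_sets hs', (size hs' <= size hs)%N & forall h, In h hs' <-> In h hs].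
Proof.
elim: hs => [|h hs [hs' [dis sz same]]]; first by exists nil.
have [hin|hout] := pselect (In h hs').
  exists hs'; split=> //; first exact: leq_trans sz (leqnSn _).
  by move=> g; rewrite same /=; split=> [|[<-|]]; [right|rewrite -same|].
exists (h :: hs'); split=> //= [|g]; last by rewrite same.
by split=> // g gin /pset_ext e; rewrite e in hout.
Qed.
End Halfspaces.

Section Magma.
Variables (M : Type) (le : M -> M -> Prop) (op : M -> M -> M) (e : M).
Hypothesis HM : tou_magma le op e.

Lemma mmulS c x : mmul op e c.+1 x = op x (mmul op e c x).
Proof. by case: c => [|c] //=; rewrite (tm_unit_r HM). Qed.

Lemma op_mono a b a' b' : le a a' -> le b b' -> le (op a b) (op a' b').
Proof. by move=> h1 h2; apply: (tm_trans HM) (tm_mono_l HM _ h1) (tm_mono_r HM _ h2). Qed.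

Lemma mmul_mono c x y : le x y -> le (mmul op e c x) (mmul op e c y).
Proof.
move=> xy; elim: c => [|c IH]; first exact: (tm_refl HM).
by rewrite !mmulS; exact: op_mono.
Qed.

Lemma mmul_unit c : mmul op e c e = e.
Proof. by elim: c => // c IH; rewrite mmulS IH (tm_unit_l HM). Qed.

Lemma mmul_leq c c' x : le e x -> (c <= c')%N -> le (mmul op e c x) (mmul op e c' x).
Proof.
move=> ex; elim: c' => [|c' IH]; first by rewrite leqn0 => /eqP->; exact: (tm_refl HM).
rewrite leq_eqVlt => /predU1P[->|]; first exact: (tm_refl HM).
rewrite ltnS => /IH h; apply: (tm_trans HM) h _; rewrite mmulS -{1}[mmul _ _ _ _](tm_unit_l HM).
exact: (tm_mono_l HM).
Qed.

Lemma mfold_le_mmul v vs x : le v x -> (forall w, In w vs -> le w x) ->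
  le (mfold op v vs) (mmul op e (size vs).+1 x).
Proof.
elim: vs v => [|w vs IH] v vx vsx; first by [].
rewrite mmulS; apply: op_mono => //; apply: IH; first by apply: vsx; left.
by move=> w' w'in; apply: vsx; right.
Qed.

Lemma exists_max (T : Type) (mu : T -> M) (h : T) (hs : list T) :
  exists2 g, In g (h :: hs) & forall g', In g' (h :: hs) -> le (mu g') (mu g).
Proof.
elim: hs h => [|h' hs IH] h.
  by exists h; [left|move=> g' [<-|//]; exact: (tm_refl HM)].
have [g gin gmax] := IH h'.
have [hg|gh] := tm_total HM (mu h) (mu g).
  by exists g; [right|move=> g' [<-//|]; exact: gmax].
exists h; first by left.
by move=> g' [<-|/gmax h1]; [exact: (tm_refl HM)|exact: (tm_trans HM) h1 gh].
Qed.
End Magma.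

(** * The depth bound of one set function *)

Section Depth.
Variables (d n : nat) (M : Type) (le : M -> M -> Prop) (op : M -> M -> M) (e : M).
Hypothesis HM : tou_magma le op e.
Variables (G : pset d -> Prop) (mu : pset d -> M).
Hypotheses (HG : good_family G) (Hmono : monotone_on le G mu) (Hsub : H_subadditive le op mu).
Hypothesis n_gt0 : (0 < n)%N.
Variables (X : pset d) (r : R).
Hypotheses (r_ge0 : 0 <= r) (Xr : forall x, X x -> forall i, `|x i| <= r).
Hypothesis Hconc : concentrated_on e mu X.
Implicit Types (a : 'rV[R]_d) (b : R).

Lemma measure_far a b : a != 0 -> r * nrm a <= b -> mu (halfspace a b) = e.
Proof.
move=> a0 rb; apply: Hconc; first exact: halfspace_open.
move=> x [hx Xx]; move: hx; rewrite /halfspace ltNge => /negP; apply.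
apply: le_trans rb; rewrite (_ : dotr _ _ = dotr (vec x) a); last by apply: eq_bigr => i _; rewrite mulrC.
by apply: dotr_le => i; rewrite mxE; exact: Xr.
Qed.

Lemma halfspace_mono a b b' : a != 0 -> b <= b' -> le (mu (halfspace a b')) (mu (halfspace a b)).
Proof.
move=> a0 bb'; have [_ [_ Gh]] := HG; apply: Hmono; do ?[apply: Gh; exact: halfspace_open].
by move=> x; apply: le_lt_trans.
Qed.

Lemma unit_le_halfspace a b : a != 0 -> le e (mu (halfspace a b)).
Proof.
move=> a0; rewrite -(measure_far (b := Num.max b (r * nrm a)) a0) ?le_max ?lexx ?orbT //.
by apply: halfspace_mono => //; rewrite le_max lexx.
Qed.

(** The zero vector defines no halfspace; its clause says that [halfspace 0 b] is empty, which makes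
    the infimum 0 there. *)
Definition shallow a b : Prop :=
  (a = 0 /\ 0 <= b) \/ (a != 0 /\ ~ le (mu (full_set d)) (mmul op e n.+1 (mu (halfspace a b)))).

Hypothesis nontrivial : ~ le (mu (full_set d)) e.

Lemma shallow_mono a b b' : b <= b' -> shallow a b -> shallow a b'.
Proof.
move=> bb' [[a0 b0]|[a0 nb]]; [left|right]; split=> //; first exact: le_trans b0 bb'.
move=> H; apply: nb; apply: (tm_trans HM) H _.
by apply: (mmul_mono HM); exact: halfspace_mono.
Qed.

Lemma shallow_far a b : r * nrm a <= b -> shallow a b.
Proof.
move=> rb; have [a0|a0] := eqVneq a 0; [left|right]; split=> //.
  by apply: le_trans rb; rewrite mulr_ge0 ?nrm_ge0.
by rewrite measure_far // (mmul_unit HM).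
Qed.

(** For a cover by at most n + 1 halfspaces, subadditivity would bound the measure of the space by n
    + 1 times the largest of theirs, against the shallowness of that one. Pairs with zero vector are
    empty sets and are dropped first. *)
Lemma shallow_not_cover (s : seq ('rV[R]_d * R)) : (size s <= n.+1)%N ->
  (forall p, In p s -> shallow p.1 p.2) ->
  ~ (forall x, exists p, In p s /\ halfspace p.1 p.2 x).
Proof.
move=> sz sh cov.
pose hs := [seq halfspace p.1 p.2 | p <- [seq p <- s | p.1 != 0]].
have hsP h : In h hs -> exists p, [/\ In p s, p.1 != 0 & h = halfspace p.1 p.2].
  by move=> /in_map_iff[p [<- /filter_In[ps p0]]]; exists p.
have [hs' [dis sz' same]] := distinct_sublist hs.
have cov' x : exists h, In h hs' /\ h x.
  have [p [ps px]] := cov x; exists (halfspace p.1 p.2); split=> //.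
  apply/same/in_map_iff; exists p; split=> //; apply/filter_In; split=> //.
  have [[p0 b0]|[//]] := sh p ps; move: px; rewrite /halfspace p0.
  by rewrite (_ : dotr 0 _ = 0) ?ltNge ?b0 //; apply: big1 => i _; rewrite mxE mul0r.
case: hs' => [|h hs'] in dis sz' same cov' *; first by have [h []] := cov' (fun=> 0).
have [g gin gmax] := exists_max HM mu h hs'.
have [p [ps p0 gE]] := hsP g ((same g).1 gin).
have [[z _]|[_]] := sh p ps; first by rewrite z eqxx in p0.
apply; rewrite -gE.
have -> : full_set d = big_union (h :: hs') by apply: pset_ext => x; split=> // _; exact: cov'.
apply: (tm_trans HM) (Hsub _ dis) _.
  apply/Forall_forall => h' h'in; have [q [_ q0 ->]] := hsP h' ((same h').1 h'in).
  exact: halfspace_open.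
apply: (tm_trans HM) (_ : le _ (mmul op e (size hs').+1 (mu g))) _.
  rewrite -(size_map mu); apply: (mfold_le_mmul HM); first by apply: gmax; left.
  by move=> w /in_map_iff[h' [<- h'in]]; apply: gmax; right.
apply: (mmul_leq HM); first by rewrite gE; exact: unit_le_halfspace.
apply: leq_trans sz' _; rewrite size_map size_filter; exact: leq_trans (count_size _ _) sz.
Qed.

Lemma dotrNl m (a x : 'rV[R]_m) : dotr (- a) x = - dotr a x.
Proof. by rewrite -sumrN; apply: eq_bigr => i _; rewrite mxE mulNr. Qed.

(** Otherwise the halfspace and a far one in the opposite direction would be a shallow cover by two
    sets, and 2 <= n + 1. *)
Lemma shallow_ge a b : shallow a b -> - (r * nrm a) <= b.
Proof.
move=> sh; rewrite leNgt; apply/negP => lt.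
apply: (@shallow_not_cover [:: (a, b); (- a, r * nrm a)]); first by rewrite /= ltnS.
  move=> p [<-//|[<-|//]]; apply: shallow_far; rewrite nrmN lexx //.
move=> x; have [h|h] := ltP b (dotr a (vec x)); first by exists (a, b); split; [left|].
exists (- a, r * nrm a); split; first by right; left.
by rewrite /halfspace /= dotrNl; lra.
Qed.

Lemma dotrDl m (a a' x : 'rV[R]_m) : dotr (a + a') x = dotr a x + dotr a' x.
Proof. by rewrite -big_split; apply: eq_bigr => i _; rewrite mxE mulrDl. Qed.

(** The new halfspace lies in the union of those of [(a, b)] and [(a', b')], and the latter misses
    [X], so it adds only [e]. *)
Lemma shallow_add a b a' b' : shallow a b -> r * nrm a' < b' -> shallow (a + a') (b + b').
Proof.
move=> sh lt; have b'0 : 0 < b' by apply: le_lt_trans lt; rewrite mulr_ge0 ?nrm_ge0.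
have [a'0|a'0] := eqVneq a' 0.
  by rewrite a'0 addr0; apply: shallow_mono sh; rewrite lerDl ltW.
have [s0|s0] := eqVneq (a + a') 0.
  left; split=> //; have := shallow_ge sh; move/eqP: s0; rewrite addr_eq0 => /eqP->.
  by rewrite nrmN; lra.
case: (sh) => [[a0 b0]|[a0 nb]].
  by rewrite a0 add0r; apply: shallow_far; lra.
right; split=> // H; apply: nb; apply: (tm_trans HM) H _; apply: (mmul_mono HM).
have [GU [_ Gh]] := HG.
have h1 := halfspace_open b a0; have h2 := halfspace_open b' a'0.
apply: (tm_trans HM) (_ : le _ (mu (union (halfspace a b) (halfspace a' b')))) _.
  apply: Hmono; [exact/Gh/halfspace_open|by apply: GU; exact: Gh|].
  move=> x; rewrite /halfspace dotrDl /union => lt'.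
  by have [?|?] := ltP b (dotr a (vec x)); [left|right; rewrite /halfspace; lra].
(* Subadditivity for the pair requires two different sets. *)
have [same|diff] := pselect (halfspace a b = halfspace a' b').
  rewrite -same (_ : union _ _ = halfspace a b); first exact: (tm_refl HM).
  by apply: pset_ext => x; split=> [[]|]; [| |left].
have -> : union (halfspace a b) (halfspace a' b') = big_union [:: halfspace a b; halfspace a' b'].
  apply: pset_ext => x; split=> [[]|[h [[<-|[<-|//]] hx]]]; [| |by left|by right].
    by exists (halfspace a b); split=> //; left.
  by exists (halfspace a' b'); split=> //; right; left.
apply: (tm_trans HM) (Hsub _ _) _; first by repeat constructor.
  by split=> // h' [<-|//] /pset_ext.
by rewrite /= (measure_far a'0 (ltW lt)) (tm_unit_r HM); exact: (tm_refl HM).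
Qed.

Lemma shallow_scale (t : R) a b : 0 < t -> shallow a b -> shallow (t *: a) (t * b).
Proof.
move=> t0 [[-> b0]|[a0 nb]]; first by left; rewrite scaler0; split=> //; exact: mulr_ge0 (ltW t0) b0.
right; split; first by rewrite scaler_eq0 negb_or gt_eqF.
suff -> : halfspace (t *: a) (t * b) = halfspace a b by [].
apply: pset_ext => x; rewrite /halfspace (_ : dotr (t *: a) _ = t * dotr a (vec x)) ?ltr_pM2l //.
by rewrite mulr_sumr; apply: eq_bigr => i _; rewrite mxE mulrA.
Qed.

Definition depth_bound a : R := inf (fun b => shallow a b).

Lemma shallow_has_inf a : has_inf (fun b => shallow a b).
Proof.
split; first by exists (r * nrm a); exact: shallow_far.
by exists (- (r * nrm a)) => b; exact: shallow_ge.
Qed.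

Lemma depth_bound_le a b : shallow a b -> depth_bound a <= b.
Proof. by move=> sh; apply: (ge_inf (shallow_has_inf a).2). Qed.

Lemma shallow_gt a b : depth_bound a < b -> shallow a b.
Proof.
move=> lt; have [b' sb' lt'] := inf_lt (shallow_has_inf a).1 lt.
exact: shallow_mono (ltW lt') sb'.
Qed.

Lemma depth_bound0 : depth_bound 0 = 0.
Proof.
apply/le_anti/andP; split; first by apply: depth_bound_le; left.
by apply: lb_le_inf (shallow_has_inf 0).1 _ => b [[_ ->//]|[]]; rewrite eqxx.
Qed.

Lemma depth_bound_scale (t : R) a : 0 < t -> depth_bound (t *: a) = t * depth_bound a.
Proof.
have half (u : R) a' : 0 < u -> depth_bound (u *: a') <= u * depth_bound a'.
  move=> u0; rewrite -ler_pdivrMl //; apply: lb_le_inf (shallow_has_inf a').1 _ => b sb.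
  by rewrite ler_pdivrMl //; apply: depth_bound_le; exact: shallow_scale.
move=> t0; apply/le_anti/andP; split; first exact: half.
rewrite -ler_pdivlMl // -{1}[a]scale1r -(mulVf (lt0r_neq0 t0)) -scalerA.
by apply: half; rewrite invr_gt0.
Qed.

Lemma depth_bound_lip a a' : depth_bound (a + a') <= depth_bound a + r * nrm a'.
Proof.
apply: (ler_add_small (C := 2)) => del del0; apply: depth_bound_le.
have sh : shallow a (depth_bound a + del) by apply: shallow_gt; rewrite ltrDl.
have := shallow_add (a' := a') (b' := r * nrm a' + del) sh.
rewrite (_ : _ + 2 * del = depth_bound a + del + (r * nrm a' + del)); last by ring.
by apply; rewrite ltrDl.
Qed.

(** Slightly raised bounds give shallow halfspaces, so some [x] lies in none of them. Adding the
    resulting inequalities at [x], whose left sides total 0, contradicts a negative sum of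
    bounds. *)
Lemma depth_bound_zero_sum N (a : 'I_N -> 'rV[R]_d) : (N <= n.+1)%N ->
  \sum_j a j = 0 -> 0 <= \sum_j depth_bound (a j).
Proof.
move=> Nn a0; rewrite leNgt; apply/negP => neg.
(* Dividing by N + 1 keeps the total of the [N] raised bounds negative. *)
pose eta := - (\sum_j depth_bound (a j)) / N.+1%:R.
have eta0 : 0 < eta by rewrite divr_gt0 ?oppr_gt0.
pose s := [seq (a j, depth_bound (a j) + eta) | j <- enum 'I_N].
apply: (@shallow_not_cover s); first by rewrite size_map -cardE card_ord.
  by move=> p /in_map_iff[j [<- _]]; apply: shallow_gt; rewrite ltrDl.
move=> x; apply: contrapT => nx.
have le_j j : dotr (a j) (vec x) <= depth_bound (a j) + eta.
  rewrite leNgt; apply/negP => lt; apply: nx; exists (a j, depth_bound (a j) + eta); split=> //.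
  apply/in_map_iff; exists j; split=> //.
  by apply: mem_In; rewrite mem_enum.
have : \sum_j dotr (a j) (vec x) <= \sum_j (depth_bound (a j) + eta).
  by apply: ler_sum => j _; exact: le_j.
have -> : \sum_j dotr (a j) (vec x) = 0.
  rewrite exchange_big big1 // => i _; rewrite -mulr_suml -summxE a0 mxE mul0r //.
rewrite big_split sumr_const card_ord /=; apply/negP; rewrite -ltNge.
have S : eta * N.+1%:R = - \sum_j depth_bound (a j) by rewrite /eta divfK ?pnatr_eq0.
by move: S; rewrite -mulr_natr -natr1; lra.
Qed.

Lemma depth_bound_deep a b : a != 0 -> b < depth_bound a ->
  le (mu (full_set d)) (mmul op e n.+1 (mu (halfspace a b))).
Proof.
move=> a0 lt; apply: contrapT => nle; move: lt; apply/negP; rewrite -leNgt.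
by apply: depth_bound_le; right.
Qed.
End Depth.

Definition depth_function d n (phi : 'rV[R]_d -> R) (r : R) : Prop :=
  [/\ 0 <= r, phi 0 = 0, forall (t : R) a, 0 < t -> phi (t *: a) = t * phi a,
      forall N (a : 'I_N -> 'rV[R]_d), (N <= n.+1)%N -> \sum_j a j = 0 -> 0 <= \sum_j phi (a j)
    & forall a b, phi (a + b) <= phi a + r * nrm b].

Lemma exists_depth_function d n (M : Type) (le : M -> M -> Prop) (op : M -> M -> M) (e : M)
    (HM : tou_magma le op e) (G : pset d -> Prop) (mu : pset d -> M) (HG : good_family G)
    (Hmono : monotone_on le G mu) (Hsub : H_subadditive le op mu) (n_gt0 : (0 < n)%N)
    (Hconc : exists X, bounded_set X /\ concentrated_on e mu X) :
  exists p : ('rV[R]_d -> R) * R, depth_function n p.1 p.2 /\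
    forall a b, a != 0 -> b < p.1 a -> le (mu (full_set d)) (mmul op e n.+1 (mu (halfspace a b))).
Proof.
have [X [[r Xr] conc]] := Hconc.
have Xr' x : X x -> forall i, `|x i| <= `|r|.
  by move=> Xx i; apply: le_trans (ler_norm r); rewrite -RabsE; apply/RleP; exact: Xr.
(* If the whole space measures at most [e], every halfspace is deep, since its measure is at least
   [e], and the zero function serves. *)
have [triv|ntriv] := pselect (le (mu (full_set d)) e).
  exists ((fun=> 0), 0); split=> [|a b a0 _].
    split=> //= [t a _|N a _ _|a b]; first by rewrite mulr0.
      by rewrite big1.
    by rewrite mul0r addr0.
  apply: (tm_trans HM) triv _; rewrite -{1}(mmul_unit HM n.+1); apply: (mmul_mono HM).
  exact: (unit_le_halfspace HG Hmono Xr' conc).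
exists (depth_bound n le op e mu, `|r|); split=> [|a b a0]; last first.
  exact (depth_bound_deep HM HG Hmono Hsub n_gt0 (normr_ge0 r) Xr' conc ntriv a0).
split=> //=.
- exact (depth_bound0 HM HG Hmono Hsub n_gt0 (normr_ge0 r) Xr' conc ntriv).
- exact (depth_bound_scale HM HG Hmono Hsub n_gt0 (normr_ge0 r) Xr' conc ntriv).
- exact (depth_bound_zero_sum HM HG Hmono Hsub n_gt0 (normr_ge0 r) Xr' conc ntriv).
- exact (depth_bound_lip HM HG Hmono Hsub n_gt0 (normr_ge0 r) Xr' conc ntriv).
Qed.

(** * Flats and the halfspaces containing them *)

Section Flat.
Variables (n k d : nat).
Hypothesis d_eq : d = (n + k)%N.
Variables (U : 'M[R]_(n, d)) (c : 'rV[R]_n).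
Hypothesis U_free : row_free U.

Definition flat : pset d := fun x => vec x *m U^T = c.

Lemma kernel_basis : exists V : 'M[R]_(k, d), row_free V /\
  forall y : 'rV[R]_d, y *m U^T = 0 <-> (y <= V)%MS.
Proof.
have rk : \rank (kermx U^T) = k.
  by rewrite mxrank_ker mxrank_tr (eqP U_free) d_eq addKn.
have [V [fV eV]] : exists V : 'M[R]_(\rank (kermx U^T), d), row_free V /\ (V :=: kermx U^T)%MS.
  by exists (row_base (kermx U^T)); split; [exact: row_base_free|exact: eq_row_base].
case: _ / rk in V fV eV *; exists V; split=> // y.
by rewrite eV; split=> [/sub_kermxP|/sub_kermxP].
Qed.

Lemma flat_is_flat : is_flat k flat.
Proof.
have [V [fV kerV]] := kernel_basis.
have [B UB] := row_freeP U_free.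
pose p := c *m B^T; have pU : p *m U^T = c by rewrite -mulmxA -trmx_mul UB trmx1 mulmx1.
have vecE (t : 'I_k -> R) i : rsum (enum 'I_k) (fun j => Rmult (t j) (V j i)) = (vec t *m V) 0 i.
  by rewrite rsumE big_enum mxE; apply: eq_bigr => j _; rewrite mxE.
exists (fun i => p 0 i), (fun j i => V j i); split=> [t t0 j|x].
  have : vec t *m V = 0 by apply/rowP => i; rewrite -vecE t0 mxE.
  by rewrite -(mul0mx _ V) => /(row_free_inj fV)/rowP/(_ j); rewrite !mxE.
split=> [xU|[t xE]].
  have /submxP[D Dx] : (vec x - p <= V)%MS by apply/kerV; rewrite mulmxBl pU xU subrr.
  exists (fun j => D 0 j) => i; rewrite vecE vecK -Dx.
  have -> : (vec x - p) 0 i = x i - p 0 i by rewrite !mxE.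
  by rewrite RplusE addrC subrK.
rewrite /flat (_ : vec x = p + vec t *m V); last by apply/rowP => i; rewrite mxE xE vecE !mxE.
by rewrite mulmxDl pU (kerV _).2 ?addr0 // submxMl.
Qed.

(** A linear form bounded below on the flat vanishes on its directions, the kernel of [U], hence
    lies in the row space of [U] and is constant on the flat. *)
Lemma flat_sub_halfspace (a : 'rV[R]_d) b : sub_set flat (halfspace a b) ->
  exists2 w, a = w *m U & b < dotr c w.
Proof.
move=> sub; have [B UB] := row_freeP U_free.
pose p := c *m B^T; have pU : p *m U^T = c by rewrite -mulmxA -trmx_mul UB trmx1 mulmx1.
have in_half (y : 'rV[R]_d) : y *m U^T = 0 -> b < dotr a (p + y).
  move=> yU; have := sub (fun i => (p + y) 0 i); rewrite /flat /halfspace vecK; apply.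
  by rewrite mulmxDl pU yU addr0.
have ker_orth (y : 'rV[R]_d) : y *m U^T = 0 -> dotr a y = 0.
  move=> yU; apply/eqP; apply: contraT => ay.
  (* This multiple of [y] leads to a point of the flat where the form equals [b], outside the open
     halfspace. *)
  have := in_half (((b - dotr a p) / dotr a y) *: y).
  rewrite -scalemxAl yU scaler0 => /(_ erefl).
  by rewrite dotrDr dotrZr divfK // addrC subrK ltxx.
have /submxP[w aE] : (a <= U)%MS.
  rewrite submxE; apply/eqP/rowP => j; rewrite [RHS]mxE.
  rewrite -(ker_orth (col j (cokermx U))^T); last first.
    by rewrite -trmx_mul colE mulmxA mulmx_coker mul0mx trmx0.
  by rewrite mxE; apply: eq_bigr => i _; rewrite [_^T _ _]mxE [col _ _ _ _]mxE.
exists w => //; have := in_half 0 (mul0mx _ _); rewrite addr0; congr (b < _).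
rewrite /dotr; transitivity ((p *m a^T) 0 0).
  by rewrite [RHS]mxE; apply: eq_bigr => i _; rewrite [a^T _ _]mxE mulrC.
by rewrite aE trmx_mul mulmxA pU [LHS]mxE; apply: eq_bigr => i _; rewrite [w^T _ _]mxE.
Qed.
End Flat.

Theorem mainTheorem1 (d k : nat) (Hd : (1 <= d)%N)
  (Hk1 : (1 <= k)%N) (Hkd : (k <= d)%N)
  (M : Type) (le : M -> M -> Prop) (op : M -> M -> M) (e : M)
  (HM : tou_magma le op e)
  (G : pset d -> Prop) (HG : good_family G)
  (mu : 'I_k -> pset d -> M)
  (Hmono : forall i, monotone_on le G (mu i))
  (Hsub : forall i, H_subadditive le op (mu i))
  (Hconc : forall i, exists X : pset d, bounded_set X /\ concentrated_on e (mu i) X) :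
  exists pi : pset d, is_flat (k - 1) pi /\
    forall h : pset d, open_halfspace h -> sub_set pi h ->
      forall i : 'I_k, le (mu i (full_set d)) (mmul op e (d - k + 2) (mu i h)).
Proof.
(* From here on [k] is the dimension of the flat, and there are k + 1 set functions. *)
case: k => [//|k] in Hk1 Hkd mu Hmono Hsub Hconc *.
pose n := (d - k.+1 + 1)%N.
have n_gt0 : (0 < n)%N by rewrite /n; lia.
have d_eq : d = (n + k)%N by rewrite /n; lia.
have H i := exists_depth_function HM HG (Hmono i) (Hsub i) n_gt0 (Hconc i).
have [F FP] := boolp.choice H; pose r := (\sum_i (F i).2)%R.
have r_i i : (0 <= (F i).2)%R by have [[]] := FP i.
have r_ge0 : (0 <= r)%R by apply: sumr_ge0.
have lip i a b : ((F i).1 (a + b) <= (F i).1 a + r * nrm b)%R.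
  have [[_ _ _ _ lip_i] _] := FP i; apply: le_trans (lip_i a b) _; rewrite lerD2l.
  apply: ler_wpM2r; first exact: nrm_ge0.
  by rewrite /r (bigD1 i) //= lerDl; apply: sumr_ge0.
have [U [c [U_free dom]]] : exists (U : 'M[R]_(n, d)) (c : 'rV[R]_n),
    row_free U /\ forall i w, (dotr c w <= (F i).1 (w *m U))%R.
  apply: (common_center d_eq _ _ _ r_ge0 lip) => i.
  - by have [[]] := FP i.
  - by have [[_ _ scale]] := FP i.
  - by have [[_ _ _ zero_sum]] := FP i.
exists (flat U c); split; first by rewrite subn1; exact: flat_is_flat.
move=> h /open_halfspaceP[a [b [a0 ->]]] sub i.
have [w aE lt] := flat_sub_halfspace U_free sub.
have -> : (d - k.+1 + 2)%N = n.+1 by rewrite /n; lia.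
by apply: (FP i).2 => //; rewrite aE; exact: lt_le_trans lt (dom i w).
Qed.
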